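(* Let $n\geq 1$, let $U(n)$ act on the space $\mathrm{Sym}(n,\mathbf{C})$ of complex symmetric $n\times n$ matrices by $g\cdot X=gXg^{t}$, and regard $\mathrm{Sym}(n,\mathbf{C})$ as a real orthogonal representation of $U(n)$. Then the discriminant $\delta$ of this representation can be written as the sum of $2\binom{2n-1}{n}$ squares of real polynomials on the real vector space underlying $\mathrm{Sym}(n,\mathbf{C})$.
   Context: The real vector space underlying $\mathrm{Sym}(n,\mathbf{C})$ carries a $U(n)$-invariant inner product (e.g. $\langle X,Y\rangle=\mathrm{Re}\,\mathrm{tr}(XY^{*})$; it is unique up to scaling). For an orthogonal representation of a compact connected Lie group $G$ on a finite-dimensional real vector space $V$, a point $v$ is regular if $\dim Gv$ is maximal among all $G$-orbits, and singular otherwise; a regular orbit is principal if moreover the number of connected components of $G_v$ is as small as possible, in which case $Gv$ is diffeomorphic to $G/H$ for a fixed closed subgroup $H$. For $v$ regular, $Gv$ is finitely covered by $G/H$; let $k$ be the index of this covering. The discriminant of $(G,V)$ is the function $\delta:V\to\mathbf{R}$ given by $\delta(v)=k^2\,\mathrm{vol}(Gv)^2$ if $v$ is regular and $\delta(v)=0$ if $v$ is singular, where $\mathrm{vol}$ is the Riemannian volume induced from $V$ (in the dimension of the principal orbits). It is a $G$-invariant homogeneous polynomial on $V$. The value of the overall positive multiplicative constant in $\delta$ is immaterial. The representation in the statement is the isotropy representation of the symmetric space $Sp(n,\mathbf{R})/U(n)$. *)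

(* Defs.v *)
From HB Require Import structures.
From mathcomp Require Import all_boot all_order all_algebra.
From mathcomp Require Import spectral complex.
From mathcomp Require Import all_classical all_reals all_analysis.
From mathcomp Require mpoly.
Import Order.TTheory GRing.Theory Num.Theory.
Import numFieldNormedType.Exports.

Set Implicit Arguments.
Unset Strict Implicit.
Unset Printing Implicit Defensive.

Local Open Scope card_scope.
Local Open Scope classical_set_scope.
Local Open Scope ring_scope.

Section Submanifolds.
Variables (R : realType) (N : nat).
Implicit Types (M : set 'rV[R]_N) (x y : 'rV[R]_N) (d : nat).

(* y is the velocity at x of a curve contained in M; for an embedded
   submanifold M these vectors form the tangent space of M at x. *)
Definition tangent_vector M x y : Prop :=
  exists c : R -> 'rV[R]_N,
    [/\ forall t, M (c t), c 0 = x & is_derive (0 : R) (1 : R) c y].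

(* The dimension of M at x, i.e. the largest number of linearly independent
   tangent vectors of M at x. *)
Definition dim_at M x : nat :=
  \max_(d < N.+1 | `[< exists A : 'M[R]_(d, N),
      row_free A /\ forall i, tangent_vector M x (row i A) >]) d.

Definition open_cube d : set 'rV[R]_d :=
  [set u : 'rV[R]_d | forall j, 0 < u ord0 j < 1].
Arguments open_cube : clear implicits.

(* Iterated Lebesgue integral over the unit cube; on the continuous functions
   to which it is applied it is the Lebesgue integral of R^d. *)
Fixpoint cube_integral d : ('rV[R]_d -> \bar R) -> \bar R :=
  match d with
  | 0 => fun f => f 0
  | d'.+1 => fun f : 'rV[R]_(1 + d') -> \bar R =>
      (\int[lebesgue_measure]_(t in `]0%R, 1%R[)
        cube_integral (fun u : 'rV[R]_d' => f (row_mx t%:M u)))%E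
  end.

(* The rows of 'J phi u are the partial derivatives of phi at u, so that
   'J phi u *m ('J phi u)^T is the matrix of the metric induced from the
   Euclidean space in the coordinates given by phi. *)
Definition volume_density d (phi : 'rV[R]_d -> 'rV[R]_N) (u : 'rV[R]_d) : R :=
  Num.sqrt (\det ('J phi u *m ('J phi u)^T)).

(* phi parametrizes a piece of M by the open unit cube.  Asking phi to be of
   class C^1 on the whole space is no restriction on the supremum in volume: a
   chart of M restricted to a compact cube extends, with values in the ambient
   space. *)
Definition patch M d (phi : 'rV[R]_d -> 'rV[R]_N) : Prop :=
  [/\ forall u, differentiable phi u,
      continuous (fun u => 'J phi u),
      {in open_cube d &, injective phi}
    & phi @` open_cube d `<=` M].

(* Riemannian volume of a d-dimensional submanifold M: the supremum of the total
   volumes, computed in the parameters by integrating the Riemannian density,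
   of the finite families of pairwise disjoint parametrized pieces. *)
Definition volume d M : \bar R :=
  ereal_sup [set v | exists (m : nat) (phi : 'I_m -> 'rV[R]_d -> 'rV[R]_N),
    [/\ forall i, patch M (phi i),
        trivIset [set: 'I_m] (fun i => phi i @` open_cube d)
      & v = (\sum_(i < m) cube_integral (EFin \o volume_density (phi i)))%E]].

End Submanifolds.

Section Representation.
Variables (R : realType) (n : nat).
Local Notation C := R[i].
Implicit Types (X Y g h : 'M[C]_n) (S H : set 'M[C]_n).

Definition sym_matrix X : Prop := X^T = X.

Definition sym_act g X : 'M[C]_n := g *m X *m g^T.

(* The space carries the inner product Re tr(X Y^* ) and the topology of its
   real coordinates; see real_coords_dot. *)
Definition real_coords X : 'rV[R]_(n * n + n * n) :=
  row_mx (mxvec (map_mx (@complex.Re R) X)) (mxvec (map_mx (@complex.Im R) X)).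

Lemma real_coords_dot X Y :
  (real_coords X *m (real_coords Y)^T) 0 0 = complex.Re (\tr (X *m Y^t*%sesqui)).
Proof.
rewrite tr_row_mx mul_row_col mxE [in LHS]mxE [X in _ + X]mxE.
have sumE (A B : 'M[R]_n) : \sum_k mxvec A 0 k * (mxvec B)^T k 0
    = \sum_i \sum_j A i j * B i j :> R.
  rewrite pair_bigA (reindex _ (curry_mxvec_bij n n)) /=.
  by apply: eq_bigr => -[i j] _ /=; rewrite [_^T _ _]mxE !mxvecE.
rewrite !sumE /mxtrace raddf_sum -big_split; apply: eq_bigr => i _ /=.
rewrite mxE raddf_sum -big_split; apply: eq_bigr => j _ /=; rewrite !mxE.
by case: (X i j) (Y i j) => a b [c e] /=; rewrite mulrN opprK.
Qed.

Definition orbit X : set 'M[C]_n :=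
  [set sym_act g X | g in [set g | g \is unitarymx]].

Definition stabilizer X : set 'M[C]_n :=
  [set g | g \is unitarymx /\ sym_act g X = X].

(* Orbits are homogeneous, so the base point is immaterial. *)
Definition orbit_dim X : nat := dim_at (real_coords @` orbit X) (real_coords X).

Definition regular X : Prop :=
  sym_matrix X /\ forall Y, sym_matrix Y -> (orbit_dim Y <= orbit_dim X)%N.

Definition components S : set (set 'rV[R]_(n * n + n * n)) :=
  connected_component (real_coords @` S) @` (real_coords @` S).

(* The number of components is finite because stabilizers are compact; it is
   compared as a cardinal. *)
Definition principal X : Prop :=
  regular X /\
  forall Y, regular Y -> components (stabilizer X) #<= components (stabilizer Y).

Definition left_cosets S H : set (set 'M[C]_n) :=
  [set [set g *m h | h in H] | g in S].

(* The principal stabilizers are the conjugates of a fixed subgroup H; the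
   covering U(n)/H -> U(n)/G_X is defined once H is conjugated into G_X, and its
   number of sheets is the index of H in G_X. *)
Definition covering_index X : nat :=
  xget 0%N [set k | exists Y, [/\ principal Y, stabilizer Y `<=` stabilizer X
                             & left_cosets (stabilizer X) (stabilizer Y) #= `I_k]].

(* The volume of a compact orbit is finite, so fine only drops the type \bar R. *)
Definition orbit_volume X : R :=
  fine (volume (orbit_dim X) (real_coords @` orbit X)).

Definition discriminant X : R :=
  if `[< regular X >] then (covering_index X)%:R ^+ 2 * orbit_volume X ^+ 2
  else 0.

(* Polynomials in the real coordinates of all the entries; restricted to the
   symmetric matrices they give all the real polynomial functions there. *)
Definition poly_eval (p : mpoly.mpoly (n * n + n * n) R) X : R :=
  mpoly.meval (fun j => real_coords X ord0 j) p.

End Representation.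

(* Main.v *)
Require Import Defs.
From HB Require Import structures.
From mathcomp Require Import all_boot all_order all_algebra.
From mathcomp Require Import spectral complex.
From mathcomp Require Import all_classical all_reals all_analysis.
From mathcomp Require mpoly.
From mathcomp Require Import fingroup perm ring lra.
Import Order.TTheory GRing.Theory Num.Theory.
Import numFieldNormedType.Exports.
Import (canonicals) mpoly.

(* Every symmetric X is u D u^t with u unitary and D = diag d, d >= 0 (Takagi).
   The orbit map sends B in u(n) to B D + D B^t, which is diagonal in suitable
   bases, with eigenvalues ("roots") d_k - d_j for j < k and d_j + d_k for
   j >= k.  The polynomial equations q(X X^* )(X X^* - mu) = 0 and
   q(X X^* ) X = 0 satisfied on the orbit bound its tangent vectors, so X is
   regular iff no root vanishes; stabilizers of regular points are then
   conjugates of {+-1}^n, and every covering index is 1.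
   For regular D0 and D, the polynomial map X |-> p(X X^* ) X with
   p(d0_j^2) d0_j = d_j maps the orbit of D0 onto that of D, and it scales the
   volume density by the constant |prod root(D) / prod root(D0)|.  Hence
   delta = c (prod root)^2 = c' |det X|^2 prod_(j < k) (d_k^2 - d_j^2)^2.
   Finally, with A = X X^*, the form v |-> det (v, A v, ..., A^(n-1) v) of degree
   n in n variables is, in the basis u, the Vandermonde determinant of d^2
   times the product of the coordinates.  Its unitarily invariant norm thus
   writes delta as a sum, over the 'C(2n - 1, n) monomials, of squared moduli
   of complex polynomials in X. *)

(** A tangent vector is the velocity of an arbitrary curve inside the orbit, given without a lift to
    U(n). Explicit curves exp (t B) therefore bound the orbit dimension only from below; an upper
    bound needs equations that can be differentiated along every curve, hence the polynomial
    identities in X X^*. Being equivariant, they may be studied at D itself. No volume is computed: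
    volume is a supremum over families of parametrized pieces, and what is accessible is the ratio
    for two orbits, by carrying the pieces of one to the other. A piece is C^1 on the whole
    parameter space and may leave the orbit outside the cube, so the carrying map must be smooth off
    the orbit too; a polynomial map is. Its inverse on the orbit is of the same kind, which turns an
    inequality of volumes into an equality. The constant c stays unspecified; since c >= 0, its
    square root is absorbed into the polynomials. The number of squares comes from symmetry: a
    coefficient of the form depends only on a multiset of indices, so equal terms are collected with
    their multiplicity. *)

Set Implicit Arguments.
Unset Strict Implicit.
Unset Printing Implicit Defensive.
Local Open Scope ring_scope.

(** * Takagi factorization *)

Section Takagi.
Variable C : numClosedFieldType.
Local Notation conjmx A := (map_mx (@Num.conj C) A).

Lemma dotmx_diag n (w : 'rV[C]_n) : 0 <= (w *m w^t*%sesqui) 0 0.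
Proof.
by rewrite mxE sumr_ge0 // => i _; rewrite !mxE mul_conjC_ge0.
Qed.

Lemma dotmx_diag_gt0 n (w : 'rV[C]_n) : w != 0 -> 0 < (w *m w^t*%sesqui) 0 0.
Proof. by move=> w0; rewrite -dotmxE dotmx_is_dotmx. Qed.

(** The antilinear map J w = conj (w X) satisfies J^2 w = w X conj X, which by symmetry of X is w X
    X^*, so the eigenvalues s^2 of J^2 are nonnegative. The claim is J v = s v, and v is built from
    an eigenvector w of J^2. *)
Lemma coneigenvector n (X : 'M[C]_n.+1) : X^T = X ->
  exists s (v : 'rV[C]_n.+1), [/\ 0 <= s, v != 0 & v *m X = s *: conjmx v].
Proof.
move=> symX.
have [l /eigenvalueP[w wl w0]] := eigenvalue_closed (X *m conjmx X) (ltn0Sn n).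
have l_ge0 : 0 <= l.
  have : 0 <= l * (w *m w^t*%sesqui) 0 0.
    have -> : l * (w *m w^t*%sesqui) 0 0 = (w *m X *m (w *m X)^t*%sesqui) 0 0.
      rewrite trmx_mul map_mxM symX !mulmxA -(mulmxA w) wl -scalemxAl.
      by rewrite [RHS]mxE.
    exact: dotmx_diag.
  by rewrite pmulr_lge0 // dotmx_diag_gt0.
pose s := sqrtC l.
have ss : s * s = l by rewrite -expr2 sqrtCK.
have s_ge0 : 0 <= s by rewrite sqrtC_ge0.
have sJ : s^* = s by exact/geC0_conj.
have JJ m1 m2 (A : 'M[C]_(m1, m2)) : conjmx (conjmx A) = A.
  by apply/matrixP => i j; rewrite !mxE conjCK.
have JZ (a : C) (A : 'rV[C]_n.+1) : conjmx (a *: A) = a^* *: conjmx A.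
  by rewrite map_mxZ.
(* This is (J + s) w, which J - s kills because J^2 w = s^2 w and s is real. *)
pose v := conjmx (w *m X) + s *: w.
have [v0|vN0] := eqVneq v 0; last first.
  exists s, v; split => //.
  rewrite mulmxDl -scalemxAl map_mxM -mulmxA.
  have -> : conjmx w *m (conjmx X *m X) = l *: conjmx w.
    rewrite -[X in X *: _](geC0_conj l_ge0) -map_mxZ -wl !map_mxM !mulmxA.
    congr (_ *m _).
    by rewrite [RHS]JJ.
  by rewrite map_mxD JJ JZ sJ scalerDr scalerA ss addrC.
(* Here J w = - s w, and antilinearity changes the sign at i w. *)
exists s, ('i *: w); split => //; first by rewrite scaler_eq0 negb_or neq0Ci w0.
have wX : w *m X = - (s *: conjmx w).
  move/eqP: v0; rewrite addr_eq0 => /eqP /(congr1 (fun A => conjmx A)).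
  by rewrite JJ map_mxN JZ sJ.
by rewrite -scalemxAl wX JZ conjCi scalerN scaleNr scalerN !scalerA mulrC.
Qed.

(** Gram-Schmidt applied to v followed by zero rows. The factor is positive, hence real, so dividing
    by it preserves v X = s conj v. *)
Lemma unitary_first_row n (v : 'rV[C]_n.+1) : v != 0 ->
  exists (S : 'M[C]_n.+1) (a : C), [/\ S \is unitarymx, 0 < a & v = a *: row 0 S].
Proof.
move=> v0; pose A : 'M[C]_(1 + n) := col_mx v 0.
have rA : row 0 A = v.
  apply/rowP => j; rewrite mxE -[RHS](col_mxEu v (0 : 'M[C]_(n, _)) 0 j).
  by congr (A _ j); exact/val_inj.
pose S := schmidt A.
have SU : S \is unitarymx by rewrite schmidt_unitarymx.
have : (v <= row 0 S)%MS.
  have := row_schmidt_sub A 0; rewrite rA (bigD1 0) //= big1 ?addsmx0 ?genmxE //.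
  by move=> k /andP[]; rewrite leqn0 => /eqP k0 /eqP; case; apply/val_inj.
move=> /sub_rVP[a va]; exists S, a; split=> //.
have := form1_row_schmidt A 0; rewrite rA {1}va -/S.
rewrite linearZl_LR /= (row_unitarymxP SU) mulr1 le_eqVlt => /predU1P[a0|//].
by move: v0; rewrite va -a0 scale0r eqxx.
Qed.

(** Induction on n: if the first row of the unitary S is a coneigenvector, orthonormality of the
    rows makes (s, 0, ..., 0) the first row of S X S^t, and symmetry gives the first column; the
    lower block is again symmetric. *)
Lemma takagi n (X : 'M[C]_n) : X^T = X ->
  exists (u : 'M[C]_n) (d : 'rV[C]_n),
    [/\ u \is unitarymx, forall i, 0 <= d 0 i & X = u *m diag_mx d *m u^T].
Proof.
elim: n X => [|n IHn] X symX.
  exists 1%:M, 0; split; first by apply/unitarymxP; apply/matrixP; case.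
    by case.
  by apply/matrixP; case.
have [s [v [s_ge0 vN0 vX]]] := coneigenvector symX.
have [S [a [SU a_gt0 vS]]] := unitary_first_row vN0.
have rSX : row 0 S *m X = s *: conjmx (row 0 S).
  move: vX; rewrite vS -scalemxAl map_mxZ /= (geC0_conj (ltW a_gt0)) scalerA.
  rewrite mulrC -scalerA => /(congr1 (fun A => a^-1 *: A)).
  by rewrite /= !scalerA (mulrA _ a) !mulVf ?lt0r_neq0 // mul1r !scale1r.
pose Y : 'M[C]_(1 + n) := S *m X *m S^T.
have symY : Y^T = Y by rewrite /Y !trmx_mul trmxK symX mulmxA.
have rY j : Y (lshift n 0) j = s * (0 == j)%:R.
  rewrite (_ : lshift n 0 = 0); last exact/val_inj.
  have -> : Y 0 j = (row 0 S *m X *m (row j S)^T) 0 0.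
    by rewrite -row_mul [LHS]mxE [RHS]mxE; apply: eq_bigr => k _; rewrite !mxE.
  rewrite rSX -scalemxAl mxE; congr (_ * _).
  have := row_unitarymxP SU j 0; rewrite dotmxE eq_sym => <-; rewrite !mxE.
  by apply: eq_bigr => k _; rewrite !mxE mulrC.
have urY : ursubmx Y = 0.
  apply/matrixP => i j; rewrite 2![LHS]mxE [RHS]mxE (ord1 i) rY.
  by rewrite -val_eqE /= mulr0.
have dlY : dlsubmx Y = 0 by rewrite -symY -trmx_ursub urY trmx0.
have [|u [d [uU d_ge0 drY]]] := IHn (drsubmx Y).
  by rewrite trmx_drsub symY.
have YE : Y = block_mx s%:M 0 0 (drsubmx Y).
  rewrite -[LHS]submxK urY dlY; congr (block_mx _ _ _ _).
  by apply/matrixP => i j; rewrite !ord1 2![LHS]mxE [RHS]mxE rY mulr1.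
pose U : 'M[C]_(1 + n) := block_mx 1%:M 0 0 u.
have UU : U \is unitarymx.
  apply/unitarymxP; rewrite tr_block_mx map_block_mx mulmx_block.
  rewrite !trmx0 !(@map_mx0 _ _ Num.conj) trmx1 map_mx1.
  rewrite !(mulmx1, mul1mx, mulmx0, mul0mx, addr0, add0r).
  by rewrite (unitarymxP uU) -scalar_mx_block.
have XE : X = S^t*%sesqui *m Y *m (S^t*%sesqui)^T.
  rewrite /Y !mulmxA -invmx_unitary // mulVmx ?unitarymx_unit // mul1mx.
  rewrite -mulmxA -trmx_mul mulVmx ?unitarymx_unit //.
  by rewrite trmx1 mulmx1.
exists (S^t*%sesqui *m U), (row_mx s%:M d); split.
- by rewrite mul_unitarymx // trmxC_unitary.
- by move=> i; rewrite mxE; case: splitP => j _; rewrite // mxE ord1 mulr1n.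
have -> : X = S^t*%sesqui *m (U *m diag_mx (row_mx s%:M d) *m U^T)
            *m (S^t*%sesqui)^T; last by rewrite trmx_mul !mulmxA.
rewrite {1}XE; congr (_ *m _ *m _); rewrite YE drY.
rewrite (@diag_mx_row _ _ _ s%:M d) /U tr_block_mx !mulmx_block !trmx0 trmx1.
rewrite !(mulmx1, mul1mx, mulmx0, mul0mx, addr0, add0r).
by rewrite (_ : diag_mx s%:M = s%:M) //; apply/matrixP => i j; rewrite !ord1 !mxE.
Qed.

End Takagi.

(** * The form det (v, A v, ..., A^(n-1) v) *)

Section CyclicForm.
Variables (C : numClosedFieldType) (n' : nat).
Local Notation n := n'.+1.
Implicit Types (A u : 'M[C]_n) (f : 'I_n -> 'I_n).

(* n! times the coefficient at e_(f 0), ..., e_(f (n-1)) of the polarization of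
   the form v |-> det (v, A v, ..., A^(n-1) v). *)
Definition cyclic_coef A f : C :=
  \sum_(s : 'S_n) \det (\matrix_(i, k) (A ^+ k) i (f (s k))).

(** The coefficient thus depends only on the multiset of values of f, i.e. on a monomial of degree
    n. *)
Lemma cyclic_coef_perm A f (t : 'S_n) : cyclic_coef A (f \o t) = cyclic_coef A f.
Proof.
rewrite /cyclic_coef [RHS](reindex_inj (mulIg t)) /=.
by apply: eq_bigr => s _; congr (\det _); apply/matrixP => i k; rewrite !mxE /= permM.
Qed.

Lemma eq_cyclic_coef A f g : f =1 g -> cyclic_coef A f = cyclic_coef A g.
Proof.
move=> fg; apply: eq_bigr => s _; congr (\det _).
by apply/matrixP => i k; rewrite !mxE fg.
Qed.

(** The permanent of the conjugated rows f 0, ..., f (n-1) of u: n! times the coefficient of the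
    polarization of v |-> \prod_m (u^* v)_m, the product of the coordinates in the basis of the
    columns of u. *)
Definition conj_perm u f : C := \sum_(s : 'S_n) \prod_i (u (f i) (s i))^*.

Lemma expmx_diag u (a : 'rV[C]_n) k : u \is unitarymx ->
  (u *m diag_mx a *m u^t*%sesqui) ^+ k
    = u *m diag_mx (map_mx (fun x => x ^+ k) a) *m u^t*%sesqui.
Proof.
move=> uU; elim: k => [|k IHk].
  rewrite expr0 (_ : map_mx _ _ = const_mx 1); last by apply/rowP => i; rewrite !mxE.
  by rewrite diag_const_mx mulmx1 (unitarymxP uU).
rewrite exprS IHk -!mulmxE !mulmxA mulmxKtV //.
rewrite -(mulmxA u) mulmx_diag; congr (_ *m diag_mx _ *m _).
by apply/rowP => i; rewrite !mxE exprS.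
Qed.

(** Every column A ^+ k e_j equals u D^k u^* e_j, so det u factors out. In the expansion of the
    remaining determinants over t, the sum over s of the conjugated factors is the same permanent
    for every t; what is left is the expansion of the Vandermonde determinant. *)
Lemma cyclic_coef_diag u (a : 'rV[C]_n) f : u \is unitarymx ->
  cyclic_coef (u *m diag_mx a *m u^t*%sesqui) f
    = \det u * \det (Vandermonde n a) * conj_perm u f.
Proof.
move=> uU; rewrite /cyclic_coef.
under eq_bigr => s _.
  have -> : \matrix_(i, k) ((u *m diag_mx a *m u^t*%sesqui) ^+ k) i (f (s k))
    = u *m \matrix_(m, k) (a 0 m ^+ k * (u (f (s k)) m)^*).
    apply/matrixP => i k; rewrite mxE expmx_diag // -mulmxA mxE [RHS]mxE.
    apply: eq_bigr => m _; rewrite mul_diag_mx !mxE //.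
  rewrite det_mulmx; over.
rewrite -mulr_sumr -mulrA; congr (_ * _).
rewrite -det_tr /determinant /conj_perm mulr_suml.
under eq_bigr => s _ do under eq_bigr => t _ do
  (under eq_bigr => i _ do rewrite mxE; rewrite big_split /= mulrA).
rewrite exchange_big /=; apply: eq_bigr => t _.
rewrite -mulr_sumr; congr (_ * _ * _).
  by apply: eq_bigr => i _; rewrite !mxE.
rewrite (reindex_inj (mulgI t^-1)%g) (reindex_inj invg_inj) /=.
apply: eq_bigr => s _; rewrite (reindex_inj (@perm_inj _ s)) /=.
by apply: eq_bigr => i _; rewrite permM !permK.
Qed.

(** The squared norm of a symmetrized tensor product of orthonormal vectors: after expanding both
    permanents, the sum over f splits into inner products of the columns s i and t i of u, so only s
    = t survives. *)
Lemma sum_conj_perm u : u \is unitarymx ->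
  \sum_(f : {ffun 'I_n -> 'I_n}) conj_perm u f * (conj_perm u f)^* = n`!%:R.
Proof.
move=> uU; have uU' : u^T \is unitarymx by rewrite trmx_unitary.
transitivity (\sum_(s : 'S_n) \sum_(t : 'S_n) ((s == t)%:R : C)); last first.
  rewrite (eq_bigr (fun=> 1)) ?sumr_const ?card_Sn // => s _.
  by rewrite (bigD1 s) //= eqxx big1 ?addr0 // => t /negbTE; rewrite eq_sym => ->.
under eq_bigr => f _ do rewrite /conj_perm rmorph_sum mulr_suml.
rewrite exchange_big; apply: eq_bigr => s _ /=.
under eq_bigr => f _ do rewrite mulr_sumr.
rewrite exchange_big; apply: eq_bigr => t _ /=.
under eq_bigr => f _ do rewrite rmorph_prod -big_split /=.
rewrite -(bigA_distr_bigA (fun i j => (u j (s i))^* * ((u j (t i))^*)^*)).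
have E i : \sum_j (u j (s i))^* * ((u j (t i))^*)^* = (s i == t i)%:R.
  rewrite eq_sym -(row_unitarymxP uU') dotmxE mxE; apply: eq_bigr => j _.
  by rewrite !mxE conjCK mulrC.
under eq_bigr => i _ do rewrite E.
have [->|/eqP st] := eqVneq s t; first by rewrite big1 // => i _; rewrite eqxx.
have [i si] : exists i, s i != t i.
  apply/existsP; rewrite -negb_forall; apply/negP => /forallP e.
  by apply: st; apply/permP => i; apply/eqP.
by rewrite (bigD1 i) //= (negbTE si) mul0r.
Qed.

Lemma unitary_det_norm u : u \is unitarymx -> `|\det u| = 1.
Proof.
move=> uU; apply/eqP; rewrite -(@eqrXn2 _ 2) ?normr_ge0 // expr1n normCK.
rewrite -(det1 C n) -(unitarymxP uU) det_mulmx.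
by rewrite det_map_mx det_tr.
Qed.

Lemma sum_cyclic_coef u (a : 'rV[C]_n) : u \is unitarymx ->
  \sum_(f : {ffun 'I_n -> 'I_n}) `|cyclic_coef (u *m diag_mx a *m u^t*%sesqui) f| ^+ 2
  = n`!%:R * `|\det (Vandermonde n a)| ^+ 2.
Proof.
move=> uU; under eq_bigr => f _ do
  rewrite cyclic_coef_diag // !normrM unitary_det_norm // mul1r exprMn.
rewrite -mulr_sumr mulrC; congr (_ * _).
by rewrite -(sum_conj_perm uU); apply: eq_bigr => f _; rewrite normCK.
Qed.

End CyclicForm.

(** A sorted tuple encodes a multiset of indices, and [m] counts the maps that sort to it. It is
    chosen before F, so that the same multiplicities serve for all matrices X. *)
Lemma sum_ffun_sorted (V : zmodType) (n' : nat) :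
  exists m : n'.+1.-tuple 'I_n'.+1 -> nat, forall F : ('I_n'.+1 -> 'I_n'.+1) -> V,
  (forall f g, f =1 g -> F f = F g) ->
  (forall f (s : 'S_n'.+1), F (f \o s) = F f) ->
  \sum_(f : {ffun 'I_n'.+1 -> 'I_n'.+1}) F f =
  \sum_(t in [set t : n'.+1.-tuple 'I_n'.+1 | sorted leq (map val t)])
     F (tnth t) *+ m t.
Proof.
pose st (f : {ffun 'I_n'.+1 -> 'I_n'.+1}) : n'.+1.-tuple 'I_n'.+1 :=
  sort_tuple (fun i j => val i <= val j)%N [tuple f i | i < n'.+1].
have stP (f : {ffun 'I_n'.+1 -> 'I_n'.+1}) : exists s : 'S_n'.+1, f =1 tnth (st f) \o s.
  have : perm_eq [tuple f i | i < n'.+1] (st f) by rewrite perm_sym perm_sort.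
  move=> /tuple_permP[s es]; exists s => i /=.
  have := congr1 (fun l => nth ord0 l i) es.
  by rewrite -!tnth_nth !tnth_mktuple.
exists (fun t => #|[pred f | st f == t]|) => F eqF symF.
rewrite (partition_big st
  (mem [set t : n'.+1.-tuple 'I_n'.+1 | sorted leq (map val t)])) /=.
  apply: eq_bigr => t _; rewrite -sumr_const; apply: eq_big => // f /eqP ft.
  by have [s fs] := stP f; rewrite (eqF _ _ fs) symF ft.
move=> f _; rewrite inE sorted_map; apply: sort_sorted => i j; exact: leq_total.
Qed.

(** * Real polynomial functions and real coordinates *)

Section PolynomialFunctions.
Variables (R : realType) (N : nat).
Local Notation C := R[i].
Local Notation Re := (@complex.Re R).
Local Notation Im := (@complex.Im R).

(** An inductive closure, so that C^1 regularity and representation by an [mpoly] are both proved by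
    induction. *)
Inductive polyfun : ('rV[R]_N -> R) -> Prop :=
| polyfun_cst c : polyfun (fun=> c)
| polyfun_coord j : polyfun (fun x => x 0 j)
| polyfunD f g : polyfun f -> polyfun g -> polyfun (fun x => f x + g x)
| polyfunM f g : polyfun f -> polyfun g -> polyfun (fun x => f x * g x).

Lemma eq_polyfun f g : f =1 g -> polyfun f -> polyfun g.
Proof. by move=> /funext ->. Qed.

Lemma polyfunN f : polyfun f -> polyfun (fun x => - f x).
Proof.
move=> pf; apply: (eq_polyfun _ (polyfunM (polyfun_cst (-1)) pf)) => x.
by rewrite mulN1r.
Qed.

Lemma polyfun_meval f : polyfun f ->
  exists p : mpoly.mpoly N R, forall x : 'rV[R]_N, mpoly.meval (fun j => x 0 j) p = f x.
Proof.
elim=> [c|j|f1 f2 _ [p1 h1] _ [p2 h2]|f1 f2 _ [p1 h1] _ [p2 h2]].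
- by exists (mpoly.mpolyC N c) => x; rewrite mpoly.mevalC.
- by exists (mpoly.mpolyX R (mpoly.mnm1 j)) => x; rewrite mpoly.mevalXU.
- by exists (p1 + p2) => x; rewrite mpoly.mevalD h1 h2.
- by exists (p1 * p2) => x; rewrite mpoly.mevalM h1 h2.
Qed.

Lemma polyfun_C1 f : polyfun f ->
  (forall x, differentiable f x) /\
  (forall v, continuous (fun x => 'd f x v : R)).
Proof.
elim=> [c|j|f1 f2 _ [d1 c1] _ [d2 c2]|f1 f2 _ [d1 c1] _ [d2 c2]].
- split=> [x|v]; first exact: differentiable_cst.
  rewrite (_ : (fun _ => _) = fun=> 0); first exact: cst_continuous.
  by apply/funext => x; rewrite diff_cst.
- split=> [x|v]; first exact: differentiable_coord.
  have @l : {linear 'rV[R]_N -> R}.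
    by exists (fun x : 'rV[R]_N => x 0 j); do 2![eexists]; do ?[constructor];
     rewrite ?mxE// => ? *; rewrite ?mxE//; move=> ?; rewrite !mxE.
  rewrite (_ : (fun _ => _) = fun=> v 0 j); first exact: cst_continuous.
  apply/funext => x; rewrite (_ : (fun _ => _) = l) //.
  by rewrite diff_lin //; exact: coord_continuous.
- split=> [x|v]; first exact: differentiableD.
  rewrite (_ : (fun _ => _) = fun x => 'd f1 x v + 'd f2 x v).
    by move=> x; exact: (continuousD (c1 v x) (c2 v x)).
  by apply/funext => x; rewrite (diffD (d1 x) (d2 x)).
- split=> [x|v]; first exact: differentiableM.
  have -> : (fun x => 'd (fun x => f1 x * f2 x) x v : R)
      = (fun x => f1 x * 'd f2 x v + f2 x * 'd f1 x v).
    by apply/funext => x; rewrite (diffM (d1 x) (d2 x)).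
  move=> x; exact: (continuousD
    (continuousM (differentiable_continuous (d1 x)) (c2 v x))
    (continuousM (differentiable_continuous (d2 x)) (c1 v x))).
Qed.

Definition cpolyfun (f : 'rV[R]_N -> C) : Prop :=
  polyfun (fun x => Re (f x)) /\ polyfun (fun x => Im (f x)).

Lemma cpolyfun_cst c : cpolyfun (fun=> c).
Proof. by split; exact: polyfun_cst. Qed.

Lemma cpolyfunD f g : cpolyfun f -> cpolyfun g -> cpolyfun (fun x => f x + g x).
Proof.
move=> [f1 f2] [g1 g2]; split.
  by apply: (eq_polyfun _ (polyfunD f1 g1)) => x; rewrite raddfD.
by apply: (eq_polyfun _ (polyfunD f2 g2)) => x; rewrite raddfD.
Qed.

Lemma cpolyfunM f g : cpolyfun f -> cpolyfun g -> cpolyfun (fun x => f x * g x).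
Proof.
move=> [f1 f2] [g1 g2]; split.
  apply: (eq_polyfun _ (polyfunD (polyfunM f1 g1) (polyfunN (polyfunM f2 g2)))).
  by move=> x; case: (f x) (g x) => a b [].
apply: (eq_polyfun _ (polyfunD (polyfunM f1 g2) (polyfunM f2 g1))) => x.
by case: (f x) (g x) => a b [].
Qed.

Lemma cpolyfun_conj f : cpolyfun f -> cpolyfun (fun x => (f x)^*).
Proof.
move=> [f1 f2]; split; first by apply: (eq_polyfun _ f1) => x; case: (f x).
by apply: (eq_polyfun _ (polyfunN f2)) => x; case: (f x).
Qed.

Lemma cpolyfun_sum (I : Type) (r : seq I) (P : pred I) f :
  (forall i, cpolyfun (f i)) -> cpolyfun (fun x => \sum_(i <- r | P i) f i x).
Proof.
move=> pf; elim: r => [|i r IHr].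
  by under eq_fun do rewrite big_nil; exact: cpolyfun_cst.
under eq_fun do rewrite big_cons.
by case: (P i) => //; exact: cpolyfunD.
Qed.

Lemma cpolyfun_prod (I : Type) (r : seq I) (P : pred I) f :
  (forall i, cpolyfun (f i)) -> cpolyfun (fun x => \prod_(i <- r | P i) f i x).
Proof.
move=> pf; elim: r => [|i r IHr].
  by under eq_fun do rewrite big_nil; exact: cpolyfun_cst.
under eq_fun do rewrite big_cons.
by case: (P i) => //; exact: cpolyfunM.
Qed.

Definition mxpolyfun m p (F : 'rV[R]_N -> 'M[C]_(m, p)) : Prop :=
  forall i j, cpolyfun (fun x => F x i j).

Lemma mxpolyfun_cst m p (A : 'M[C]_(m, p)) : mxpolyfun (fun=> A).
Proof. by move=> i j; exact: cpolyfun_cst. Qed.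

Lemma mxpolyfunD m p (F G : 'rV[R]_N -> 'M[C]_(m, p)) :
  mxpolyfun F -> mxpolyfun G -> mxpolyfun (fun x => F x + G x).
Proof.
by move=> pF pG i j; under eq_fun do rewrite mxE; exact: cpolyfunD.
Qed.

Lemma mxpolyfunM m p q (F : 'rV[R]_N -> 'M[C]_(m, p)) (G : 'rV[R]_N -> 'M[C]_(p, q)) :
  mxpolyfun F -> mxpolyfun G -> mxpolyfun (fun x => F x *m G x).
Proof.
move=> pF pG i j; under eq_fun do rewrite mxE.
by apply: cpolyfun_sum => k; exact: cpolyfunM.
Qed.

Lemma mxpolyfun_adj m p (F : 'rV[R]_N -> 'M[C]_(m, p)) :
  mxpolyfun F -> mxpolyfun (fun x => (F x)^t*%sesqui).
Proof.
by move=> pF i j; under eq_fun do rewrite !mxE; exact: cpolyfun_conj.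
Qed.

Lemma mxpolyfun_exp m (F : 'rV[R]_N -> 'M[C]_m.+1) k :
  mxpolyfun F -> mxpolyfun (fun x => F x ^+ k).
Proof.
move=> pF; elim: k => [|k IHk]; first exact: mxpolyfun_cst.
by under eq_fun do rewrite exprS -mulmxE; exact: mxpolyfunM.
Qed.

Lemma mxpolyfun_horner m (F : 'rV[R]_N -> 'M[C]_m.+1) p :
  mxpolyfun F -> mxpolyfun (fun x => horner_mx (F x) p).
Proof.
move=> pF; elim/poly_ind: p => [|p c IHp].
  by under eq_fun do rewrite rmorph0; exact: mxpolyfun_cst.
under eq_fun do rewrite rmorphD rmorphM /= horner_mx_X horner_mx_C -mulmxE.
by apply: mxpolyfunD; [exact: mxpolyfunM|exact: mxpolyfun_cst].
Qed.

Lemma cpolyfun_det m (F : 'rV[R]_N -> 'M[C]_m) :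
  mxpolyfun F -> cpolyfun (fun x => \det (F x)).
Proof.
move=> pF; apply: cpolyfun_sum => s; apply: cpolyfunM; first exact: cpolyfun_cst.
by apply: cpolyfun_prod.
Qed.

End PolynomialFunctions.

(** * Real coordinates and derivatives of matrix-valued curves *)

Section RealCoordinates.
Variables (R : realType) (n' : nat).
Local Notation n := n'.+1.
Local Notation N := (n * n + n * n)%N.
Local Notation C := R[i].
Local Notation Re := (@complex.Re R).
Local Notation Im := (@complex.Im R).

Definition complex_coords (x : 'rV[R]_N) : 'M[C]_n :=
  \matrix_(i, j) Complex (x 0 (lshift _ (mxvec_index i j)))
                         (x 0 (rshift _ (mxvec_index i j))).

Lemma real_coords_re (X : 'M[C]_n) i j :
  real_coords X 0 (lshift _ (mxvec_index i j)) = Re (X i j).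
Proof. by rewrite row_mxEl mxvecE mxE. Qed.

Lemma real_coords_im (X : 'M[C]_n) i j :
  real_coords X 0 (rshift _ (mxvec_index i j)) = Im (X i j).
Proof. by rewrite row_mxEr mxvecE mxE. Qed.

Lemma real_coordsK : cancel (@real_coords R n) complex_coords.
Proof.
move=> X; apply/matrixP => i j; rewrite mxE real_coords_re real_coords_im.
by case: (X i j).
Qed.

Lemma coord_ind (P : 'I_N -> Prop) :
  (forall i j, P (lshift _ (mxvec_index i j))) ->
  (forall i j, P (rshift _ (mxvec_index i j))) -> forall k, P k.
Proof.
move=> Pl Pr k; rewrite -(fintype.splitK k); case: (fintype.split k) => l /=;
by case/mxvec_indexP: l => i j.
Qed.

Lemma complex_coordsK : cancel complex_coords (@real_coords R n).
Proof.
move=> x; apply/rowP; apply: coord_ind => i j.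
  by rewrite real_coords_re mxE.
by rewrite real_coords_im mxE.
Qed.

Lemma real_coords_inj : injective (@real_coords R n).
Proof. exact: can_inj real_coordsK. Qed.

Lemma real_coordsD (X Y : 'M[C]_n) :
  real_coords (X + Y) = real_coords X + real_coords Y.
Proof.
apply/rowP; apply: coord_ind => i j; rewrite [RHS]mxE.
  by rewrite !real_coords_re mxE raddfD.
by rewrite !real_coords_im mxE raddfD.
Qed.

Lemma real_coordsZ a (X : 'M[C]_n) : real_coords (a%:C%C *: X) = a *: real_coords X.
Proof.
apply/rowP; apply: coord_ind => i j; rewrite [RHS]mxE.
  by rewrite !real_coords_re mxE; case: (X i j) => x y /=; rewrite mul0r subr0.
by rewrite !real_coords_im mxE; case: (X i j) => x y /=; rewrite mul0r addr0.
Qed.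

Lemma real_coords0 : real_coords (0 : 'M[C]_n) = 0.
Proof. by have := real_coordsZ 0 0; rewrite scaler0 scale0r. Qed.

Lemma real_coords_sum (I : finType) (F : I -> 'M[C]_n) :
  real_coords (\sum_i F i) = \sum_i real_coords (F i).
Proof. exact: (big_morph _ real_coordsD real_coords0). Qed.

Lemma mxpolyfun_complex_coords : mxpolyfun complex_coords.
Proof. by move=> i j; split; under eq_fun do rewrite mxE /=; exact: polyfun_coord. Qed.

Lemma polyfun_real_coords M (F : 'rV[R]_M -> 'M[C]_n) : mxpolyfun F ->
  forall j, polyfun (fun x => real_coords (F x) 0 j).
Proof.
move=> pF; apply: coord_ind => i j; have [p1 p2] := pF i j.
  by under eq_fun do rewrite real_coords_re.
by under eq_fun do rewrite real_coords_im.
Qed.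

Lemma is_derive_mxP (V : normedModType R) m p (M : V -> 'M[R]_(m, p)) t v dM :
  is_derive t v M dM <-> forall i j, is_derive t v (fun x => M x i j) (dM i j).
Proof.
split=> [[dv e] i j|h].
  split; first by move/derivable_mxP: dv; apply.
  by rewrite -e derive_mx // mxE.
have dv : derivable M t v by apply/derivable_mxP => i j; have [] := h i j.
split=> //; rewrite derive_mx //; apply/matrixP => i j; rewrite mxE.
by have [] := h i j.
Qed.

(** The derivative at time 0, in real coordinates, to match [tangent_vector]. *)
Definition cderive (c : R -> 'M[C]_n) (dc : 'M[C]_n) : Prop :=
  is_derive (0 : R) (1 : R) (fun t => real_coords (c t)) (real_coords dc).

Lemma cderiveP c dc : cderive c dc <->
  forall i j, is_derive (0 : R) (1 : R) (fun t => Re (c t i j)) (Re (dc i j)) /\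
              is_derive (0 : R) (1 : R) (fun t => Im (c t i j)) (Im (dc i j)).
Proof.
rewrite /cderive is_derive_mxP; split=> [h i j|h i].
  have h1 := h 0 (lshift _ (mxvec_index i j)).
  have h2 := h 0 (rshift _ (mxvec_index i j)).
  move: h1 h2; rewrite !real_coords_re !real_coords_im.
  under eq_fun do rewrite real_coords_re.
  by under [X in _ -> is_derive _ _ X _ -> _]eq_fun do rewrite real_coords_im.
rewrite ord1; apply: coord_ind => j k; have [h1 h2] := h j k.
  by under eq_fun do rewrite real_coords_re; rewrite real_coords_re.
by under eq_fun do rewrite real_coords_im; rewrite real_coords_im.
Qed.

Lemma cderive_unique c dc dc' : cderive c dc -> cderive c dc' -> dc = dc'.
Proof. by move=> [_ e] [_ e']; apply: real_coords_inj; rewrite -e -e'. Qed.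

Lemma cderive_cst A : cderive (fun=> A) 0.
Proof. by rewrite /cderive real_coords0; exact: is_derive_cst. Qed.

Lemma cderiveD c1 c2 d1 d2 : cderive c1 d1 -> cderive c2 d2 ->
  cderive (fun t => c1 t + c2 t) (d1 + d2).
Proof.
move=> h1 h2; rewrite /cderive real_coordsD.
under eq_fun do rewrite real_coordsD.
exact: is_deriveD.
Qed.

Lemma is_derive_bigsum m (f : 'I_m -> R -> R) df (t v : R) :
  (forall i, is_derive t v (f i) (df i)) ->
  is_derive t v (fun x => \sum_i f i x) (\sum_i df i).
Proof.
move=> h; rewrite (_ : (fun x => _) = \sum_i f i).
  exact: is_derive_sum.
by apply/funext => x; rewrite fct_sumE.
Qed.

Lemma cderiveM c1 c2 d1 d2 : cderive c1 d1 -> cderive c2 d2 ->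
  cderive (fun t => c1 t *m c2 t) (d1 *m c2 0 + c1 0 *m d2).
Proof.
move=> /cderiveP h1 /cderiveP h2; apply/cderiveP => i j.
have E1 : (fun t => Re ((c1 t *m c2 t) i j)) = fun t => \sum_k
   (Re (c1 t i k) * Re (c2 t k j) - Im (c1 t i k) * Im (c2 t k j)).
  apply/funext => t; rewrite mxE raddf_sum; apply: eq_bigr => k _ /=.
  by case: (c1 t i k) (c2 t k j) => a b [].
have E2 : (fun t => Im ((c1 t *m c2 t) i j)) = fun t => \sum_k
   (Re (c1 t i k) * Im (c2 t k j) + Im (c1 t i k) * Re (c2 t k j)).
  apply/funext => t; rewrite mxE raddf_sum; apply: eq_bigr => k _ /=.
  by case: (c1 t i k) (c2 t k j) => a b [].
rewrite E1 E2 !mxE !raddfD !raddf_sum -!big_split /=; split.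
- apply: is_derive_bigsum => k; have [? ?] := h1 i k; have [? ?] := h2 k j.
  apply: is_derive_eq.
  case: (c1 0 i k) (c2 0 k j) (d1 i k) (d2 k j) => a b [a' b'] [e f] [e' f'] /=.
  by rewrite /GRing.scale /=; ring.
- apply: is_derive_bigsum => k; have [? ?] := h1 i k; have [? ?] := h2 k j.
  apply: is_derive_eq.
  case: (c1 0 i k) (c2 0 k j) (d1 i k) (d2 k j) => a b [a' b'] [e f] [e' f'] /=.
  by rewrite /GRing.scale /=; ring.
Qed.

Lemma cderive_tr c d : cderive c d -> cderive (fun t => (c t)^T) d^T.
Proof.
move=> /cderiveP h; apply/cderiveP => i j; rewrite mxE.
under eq_fun do rewrite mxE.
by under [X in _ /\ is_derive _ _ X _]eq_fun do rewrite mxE.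
Qed.

Lemma cderive_adj c d : cderive c d -> cderive (fun t => (c t)^t*%sesqui) (d^t*%sesqui).
Proof.
move=> /cderiveP h; apply/cderiveP => i j; have [h1 h2] := h j i; split.
  have -> : (fun t => Re ((c t)^t*%sesqui i j)) = fun t => Re (c t j i).
    by apply/funext => t; rewrite !mxE; case: (c t j i).
  by apply: is_derive_eq; rewrite !mxE; case: (d j i).
have -> : (fun t => Im ((c t)^t*%sesqui i j)) = fun t => - Im (c t j i).
  by apply/funext => t; rewrite !mxE; case: (c t j i).
by apply: is_derive_eq; rewrite !mxE; case: (d j i).
Qed.

Lemma cderiveZ (f : R -> R) df A : is_derive (0 : R) (1 : R) f df ->
  cderive (fun t => (f t)%:C%C *: A) (df%:C%C *: A).
Proof.
move=> h; rewrite /cderive real_coordsZ; apply/is_derive_mxP => i j; rewrite mxE.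
under eq_fun do rewrite real_coordsZ mxE.
by apply: is_derive_eq; rewrite /GRing.scale /= mulr0 add0r mulrC.
Qed.

Lemma cderive_mulr c d A B : cderive c d ->
  cderive (fun t => A *m c t *m B) (A *m d *m B).
Proof.
move=> h.
have := cderiveM (cderiveM (cderive_cst A) h) (cderive_cst B).
by rewrite mul0mx add0r mulmx0 addr0.
Qed.

Lemma differentiable_coords m p (F : 'rV[R]_m -> 'rV[R]_p) x :
  (forall j, differentiable (fun x => F x 0 j) x) -> differentiable F x.
Proof.
move=> h; have -> : F = \sum_j (fun x => F x 0 j *: (delta_mx 0 j : 'rV[R]_p)).
  by apply/funext => y; rewrite fct_sumE [LHS]row_sum_delta.
by apply: differentiable_sum => j; apply: differentiableZl.
Qed.

Lemma polymap_differentiable M (F : 'rV[R]_M -> 'M[C]_n) x : mxpolyfun F ->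
  differentiable (fun x => real_coords (F x)) x.
Proof.
move=> pF; apply: differentiable_coords => j.
by have [] := polyfun_C1 (polyfun_real_coords pF j).
Qed.

(** The chain rule, used in two ways: to differentiate a polynomial identity along an unknown curve,
    and to read off the differential of a polynomial map from known curves. *)
Lemma polymap_cderive (F : 'M[C]_n -> 'M[C]_n) c d :
  mxpolyfun (F \o complex_coords) -> cderive c d ->
  cderive (F \o c) (complex_coords
    ('d (fun x => real_coords (F (complex_coords x))) (real_coords (c 0))
       (real_coords d))).
Proof.
move=> pF [dc e]; rewrite /cderive complex_coordsK.
set G := fun x => real_coords (F (complex_coords x)).
have dG (x : 'rV[R]_N) : differentiable G x by exact: (polymap_differentiable _ pF).
have -> : (fun t => real_coords ((F \o c) t)) = G \o (fun t => real_coords (c t)).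
  by apply/funext => t; rewrite /G /= real_coordsK.
have dcc : differentiable (fun t => real_coords (c t)) (0 : R).
  exact/derivable1_diffP.
have dGc := differentiable_comp dcc (dG _).
split; first exact/derivable1_diffP.
by rewrite deriveE // diff_comp // -e deriveE.
Qed.

End RealCoordinates.

(** * Generators of u(n) and curves in the orbits *)

Section Congruence.
Variables (C : numClosedFieldType) (n : nat).
Implicit Types (g h X A B : 'M[C]_n).

Lemma congrmxM g h X : g *m (h *m X *m h^T) *m g^T = (g *m h) *m X *m (g *m h)^T.
Proof. by rewrite trmx_mul !mulmxA. Qed.

Lemma congrmx_unitaryK g X : g \is unitarymx ->
  g^t*%sesqui *m (g *m X *m g^T) *m (g^t*%sesqui)^T = X.
Proof.
move=> gU; have E : g^t*%sesqui *m g = 1%:M by exact/mulmx1C/unitarymxP.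
by rewrite congrmxM E trmx1 mulmx1 mul1mx.
Qed.

Lemma congrmx_unitaryVK g X : g \is unitarymx ->
  g *m (g^t*%sesqui *m X *m (g^t*%sesqui)^T) *m g^T = X.
Proof.
by move=> gU; rewrite congrmxM (unitarymxP gU) trmx1 mulmx1 mul1mx.
Qed.

Lemma congrmx_sym g X : X^T = X -> (g *m X *m g^T)^T = g *m X *m g^T.
Proof. by move=> XT; rewrite !trmx_mul trmxK XT mulmxA. Qed.

Lemma congrmxZ g a X : g *m (a *: X) *m g^T = a *: (g *m X *m g^T).
Proof. by rewrite -scalemxAr -scalemxAl. Qed.

Lemma gram_congrmx g A : g \is unitarymx ->
  g *m A *m g^T *m (g *m A *m g^T)^t*%sesqui = g *m (A *m A^t*%sesqui) *m g^t*%sesqui.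
Proof.
move=> gU; have gTU : g^T \is unitarymx by rewrite trmx_unitary.
rewrite trmx_mul map_mxM mulmxA mulmxtVK //.
by rewrite trmx_mul map_mxM !mulmxA.
Qed.

Lemma mul_unitary_conj g A B : g \is unitarymx ->
  g *m A *m g^t*%sesqui *m (g *m B *m g^t*%sesqui) = g *m (A *m B) *m g^t*%sesqui.
Proof. by move=> gU; rewrite !mulmxA mulmxKtV. Qed.

Lemma mul_unitary_congr g A B : g \is unitarymx ->
  g *m A *m g^t*%sesqui *m (g *m B *m g^T) = g *m (A *m B) *m g^T.
Proof. by move=> gU; rewrite !mulmxA mulmxKtV. Qed.

Lemma unitary_conj_scalar g a : g \is unitarymx ->
  g *m a%:M *m g^t*%sesqui = a%:M.
Proof. by move=> gU; rewrite mul_mx_scalar -scalemxAl (unitarymxP gU) scalemx1. Qed.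

Lemma mul_diag0 g h (v : 'rV[C]_n) : (forall i, v 0 i = 0) -> g *m diag_mx v *m h = 0.
Proof.
move=> v0; rewrite (_ : v = 0); last by apply/rowP => i; rewrite v0 mxE.
by rewrite raddf0 mulmx0 mul0mx.
Qed.

End Congruence.

Lemma horner_mx_unitary_conj (C : numClosedFieldType) n (u A : 'M[C]_n.+1) p :
  u \is unitarymx ->
  horner_mx (u *m A *m u^t*%sesqui) p = u *m horner_mx A p *m u^t*%sesqui.
Proof.
move=> uU; elim/poly_ind: p => [|p c IHp].
  by rewrite !rmorph0 mulmx0 mul0mx.
rewrite !rmorphD !rmorphM /= !horner_mx_X !horner_mx_C -!mulmxE IHp.
by rewrite mulmxDr mulmxDl mul_unitary_conj // unitary_conj_scalar.
Qed.

(** * Identities behind the exponentials of the generators *)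

Section DeltaCubes.
Variables (F : comNzRingType) (n : nat).
Implicit Types (j k : 'I_n) (B : 'M[F]_n).

Lemma delta_sub_cube j k : j != k ->
  let B : 'M[F]_n := delta_mx j k - delta_mx k j in B *m B *m B = - B.
Proof.
move=> jk B; have kj : k != j by rewrite eq_sym.
have BB : B *m B = - (delta_mx j j + delta_mx k k).
  rewrite /B mulmxBl !mulmxBr !mul_delta_mx !mul_delta_mx_0 //.
  by rewrite sub0r subr0 opprD.
rewrite BB mulNmx mulmxDl /B !mulmxBr !mul_delta_mx !mul_delta_mx_0 //.
by rewrite sub0r subr0.
Qed.

Lemma delta_add_cube j k : j != k ->
  let B : 'M[F]_n := delta_mx j k + delta_mx k j in B *m B *m B = B.
Proof.
move=> jk B; have kj : k != j by rewrite eq_sym.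
have BB : B *m B = delta_mx j j + delta_mx k k.
  rewrite /B mulmxDl !mulmxDr !mul_delta_mx !mul_delta_mx_0 //.
  by rewrite add0r addr0.
rewrite BB mulmxDl /B !mulmxDr !mul_delta_mx !mul_delta_mx_0 //.
by rewrite add0r addr0.
Qed.

(** With s = sin t and m = 1 - cos t the hypothesis on s * s is sin^2 + cos^2 = 1, and the two
    factors are exp (t B) and exp (- t B). *)
Lemma exp_skew_inverse B (s m : F) : s * s = m + m - m * m -> B *m B *m B = - B ->
  (1%:M + s *: B + m *: (B *m B)) *m (1%:M + s *: - B + m *: (B *m B)) = 1%:M.
Proof.
move=> sm B3.
have B3' : B *m (B *m B) = - B by rewrite mulmxA.
have B4 : B *m B *m (B *m B) = - (B *m B) by rewrite mulmxA B3 mulNmx.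
rewrite !(mulmxDl, mulmxDr) -!(scalemxAl, scalemxAr) !mulmxN B3 B3' B4.
rewrite !(mul1mx, mulmx1).
move: (B *m B) => B2; apply/matrixP => i j; rewrite !mxE.
move: (B i j) (B2 i j) (_%:R) => b b2 e.
transitivity (e + (m + m - m * m - s * s) * b2); first by ring.
by rewrite sm subrr mul0r addr0.
Qed.

Lemma scaler_cross_sub (V : lmodType F) (x y : F) (A B : V) :
  y *: A - x *: B + (y *: B - x *: A) = (y - x) *: (A + B).
Proof. by rewrite scalerBl !scalerDr addrACA -opprD [X in _ - X]addrC. Qed.

Lemma scaler_cross_add (V : lmodType F) (x y : F) (A B : V) :
  y *: A + x *: B + (y *: B + x *: A) = (x + y) *: (A + B).
Proof.
by rewrite scalerDl !scalerDr addrACA addrC; congr (_ + _); exact: addrC.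
Qed.

End DeltaCubes.

Section Generators.
Variables (R : realType) (n' : nat).
Local Notation n := n'.+1.
Local Notation N := (n * n + n * n)%N.
Local Notation C := R[i].
Local Notation Re := (@complex.Re R).
Local Notation Im := (@complex.Im R).
Implicit Types (d : 'rV[R]_n) (j k : 'I_n).

Lemma unitarycM (g h : 'M[C]_n) :
  g \is unitarymx -> h \is unitarymx -> g *m h \is unitarymx.
Proof. exact: mul_unitarymx. Qed.

Lemma unitarycJ (g : 'M[C]_n) : g \is unitarymx -> g^t*%sesqui \is unitarymx.
Proof. by rewrite trmxC_unitary. Qed.

Definition cdiag d : 'M[C]_n := diag_mx (map_mx (real_complex R) d).

(** A real basis of u(n) indexed by ordered pairs. The diagonal case is separate so that B^3 = - B
    holds for every generator. *)
Definition skew_gen j k : 'M[C]_n :=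
  if (j < k)%N then delta_mx j k - delta_mx k j
  else if j == k then 'i%C *: delta_mx j j
  else 'i%C *: (delta_mx j k + delta_mx k j).

(** A real basis of the symmetric matrices with imaginary diagonal, a complement of the real
    diagonal ones. *)
Definition tangent_gen j k : 'M[C]_n :=
  if (j < k)%N then delta_mx j k + delta_mx k j else skew_gen j k.

(** Up to sign, the restricted roots of Sp(n,R)/U(n), of type C_n; j = k gives the long root 2
    d_j. *)
Definition root_val d j k : R :=
  if (j < k)%N then d 0 k - d 0 j else d 0 j + d 0 k.

Let trD (A B : 'M[C]_n) : (A + B)^T = A^T + B^T.
Proof. by apply/matrixP => i j; rewrite !mxE. Qed.

Let trB (A B : 'M[C]_n) : (A - B)^T = A^T - B^T.
Proof. by apply/matrixP => i j; rewrite !mxE. Qed.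

Let trZ a (A : 'M[C]_n) : (a *: A)^T = a *: A^T.
Proof. by apply/matrixP => i j; rewrite !mxE. Qed.

Lemma mul_delta_diag d j k :
  delta_mx j k *m cdiag d = (d 0 k)%:C%C *: delta_mx j k.
Proof.
apply/matrixP => a b; rewrite /cdiag mul_mx_diag !mxE.
by case: (b =P k) => [->|_]; rewrite ?andbF ?mulr0 ?mul0r // mulrC.
Qed.

Lemma mul_diag_delta d j k :
  cdiag d *m delta_mx j k = (d 0 j)%:C%C *: delta_mx j k.
Proof.
apply/matrixP => a b; rewrite /cdiag mul_diag_mx !mxE.
by case: (a =P j) => [->|_]; rewrite ?mulr0 ?mul0r.
Qed.

Lemma skew_gen_diag d j k :
  skew_gen j k *m cdiag d + cdiag d *m (skew_gen j k)^T
    = (root_val d j k)%:C%C *: tangent_gen j k.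
Proof.
rewrite /tangent_gen /root_val /skew_gen; case: ltnP => _; last case: (j =P k) => [<-|_].
- rewrite trB !trmx_delta mulmxBl mulmxBr !mul_delta_diag !mul_diag_delta.
  by rewrite rmorphB scaler_cross_sub.
- rewrite trZ trmx_delta -scalemxAl -scalemxAr mul_delta_diag mul_diag_delta.
  by rewrite rmorphD /= !scalerA -scalerDl -mulrDr mulrC.
- rewrite trZ trD !trmx_delta -scalemxAl -scalemxAr mulmxDl mulmxDr.
  rewrite !mul_delta_diag !mul_diag_delta rmorphD /= -scalerDr [RHS]scalerA.
  rewrite [_ * 'i%C]mulrC -[RHS]scalerA; congr (_ *: _).
  exact: scaler_cross_add.
Qed.

Lemma skew_gen_adj j k : (skew_gen j k)^t*%sesqui = - skew_gen j k.
Proof.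
have iJ : ('i%C : C)^* = - 'i%C by apply/eqP; rewrite eq_complex /= oppr0 !eqxx.
have bJ (b : bool) : (b%:R : C)^* = b%:R by rewrite conjC_nat.
apply/matrixP => a b; rewrite /skew_gen.
case: ltnP => _; last case: (j =P k) => [_|_]; rewrite !mxE.
- by rewrite rmorphB /= !bJ opprB !(andbC (b == _)).
- by rewrite rmorphM /= iJ bJ mulNr andbC.
- by rewrite rmorphM rmorphD /= iJ !bJ mulNr !(andbC (b == _)) addrC.
Qed.

Lemma skew_gen_cube j k : skew_gen j k *m skew_gen j k *m skew_gen j k = - skew_gen j k.
Proof.
have ii : 'i%C * 'i%C = -1 :> C by rewrite -expr2 sqr_i.
rewrite /skew_gen; case: ltnP => jk; last case: (j =P k) => [_|/eqP jk'].
- by apply: delta_sub_cube; rewrite neq_ltn jk.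
- rewrite -!(scalemxAl, scalemxAr) !mul_delta_mx !scalerA mulrA ii mulN1r.
  by rewrite scaleNr.
- rewrite -!(scalemxAl, scalemxAr) !scalerA mulrA ii mulN1r scaleNr.
  by rewrite (delta_add_cube _ jk').
Qed.

(* This is exp (t B) when B^3 = - B. *)
Definition skew_curve (B : 'M[C]_n) (t : R) : 'M[C]_n :=
  1%:M + (sin t)%:C%C *: B + (1 - cos t)%:C%C *: (B *m B).

Lemma skew_curve0 B : skew_curve B 0 = 1%:M.
Proof. by rewrite /skew_curve sin0 cos0 subrr !scale0r !addr0. Qed.

Lemma skew_curve_unitary B t : B^t*%sesqui = - B -> B *m B *m B = - B ->
  skew_curve B t \is unitarymx.
Proof.
move=> BJ B3; apply/unitarymxP; rewrite /skew_curve.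
have cJ (x : R) : (x%:C%C)^* = x%:C%C by apply/eqP; rewrite eq_complex /= oppr0 !eqxx.
rewrite !trD !trZ trmx1 trmx_mul !map_mxD !map_mxZ /= map_mx1 map_mxM BJ !cJ.
rewrite mulNmx mulmxN opprK; apply: exp_skew_inverse => //.
rewrite -!rmorphM -rmorphD -rmorphB; congr (_%:C%C).
by have := cos2Dsin2 t; rewrite !expr2 => h; lra.
Qed.

Lemma cderive_skew_curve B : cderive (skew_curve B) B.
Proof.
have h1 : is_derive (0 : R) (1 : R) sin 1.
  by have := is_derive_sin (0 : R); rewrite cos0.
have h2 : is_derive (0 : R) (1 : R) (fun t => 1 - cos t) 0.
  by apply: is_derive_eq; rewrite sin0 !oppr0 mulr0.
have := cderiveD (cderiveD (cderive_cst 1%:M) (cderiveZ B h1)) (cderiveZ (B *m B) h2).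
by rewrite scale1r scale0r add0r addr0.
Qed.

Definition orbit_curve (u : 'M[C]_n) j k d (t : R) : 'M[C]_n :=
  u *m skew_curve (skew_gen j k) t *m cdiag d *m (u *m skew_curve (skew_gen j k) t)^T.

Lemma orbit_curve0 u j k d : orbit_curve u j k d 0 = u *m cdiag d *m u^T.
Proof. by rewrite /orbit_curve skew_curve0 mulmx1. Qed.

Lemma orbit_curveE u j k d t : orbit_curve u j k d t =
  u *m (skew_curve (skew_gen j k) t *m cdiag d *m (skew_curve (skew_gen j k) t)^T) *m u^T.
Proof. by rewrite congrmxM. Qed.

Lemma cderive_orbit_curve (u : 'M[C]_n) j k d :
  cderive (orbit_curve u j k d) ((root_val d j k)%:C%C *: (u *m tangent_gen j k *m u^T)).
Proof.
have h := cderive_skew_curve (skew_gen j k).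
have := cderive_mulr u u^T (cderiveM (cderiveM h (cderive_cst (cdiag d))) (cderive_tr h)).
rewrite skew_curve0 trmx1 mulmx1 mulmx0 addr0 mul1mx skew_gen_diag congrmxZ.
by under eq_fun do rewrite -orbit_curveE.
Qed.

Lemma cdiag_tr d : (cdiag d)^T = cdiag d.
Proof. exact: tr_diag_mx. Qed.

Lemma sym_conj_cdiag (u : 'M[C]_n) d : sym_matrix (u *m cdiag d *m u^T).
Proof. exact/congrmx_sym/cdiag_tr. Qed.

Lemma orbit_cdiagP (u : 'M[C]_n) d (Y : 'M[C]_n) : u \is unitarymx ->
  Defs.orbit (u *m cdiag d *m u^T) Y <->
  exists2 g, g \is unitarymx & Y = g *m cdiag d *m g^T.
Proof.
move=> uU; split=> [[g gU <-]|[g gU ->]].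
  exists (g *m u).
    exact: (unitarycM gU uU).
  exact: congrmxM.
exists (g *m u^t*%sesqui).
  exact: (unitarycM gU (unitarycJ uU)).
apply: etrans (esym (congrmxM g _ _)) _.
exact: (congr1 (fun A => g *m A *m g^T) (congrmx_unitaryK _ uU)).
Qed.

Lemma orbit_curve_orbit (u : 'M[C]_n) j k d t : u \is unitarymx ->
  Defs.orbit (u *m cdiag d *m u^T) (orbit_curve u j k d t).
Proof.
move=> uU; apply/orbit_cdiagP; first exact: uU.
exists (u *m skew_curve (skew_gen j k) t); last by [].
apply: (unitarycM uU).
by apply: skew_curve_unitary; [exact: skew_gen_adj|exact: skew_gen_cube].
Qed.

End Generators.

(** * Tangent vectors and dimension of the orbits *)

Section TangentVectors.
Variables (R : realType) (n' : nat).
Local Notation n := n'.+1.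
Local Notation N := (n * n + n * n)%N.
Local Notation C := R[i].
Local Notation Re := (@complex.Re R).
Local Notation Im := (@complex.Im R).
Implicit Types (d : 'rV[R]_n) (j k : 'I_n).

Lemma cderive_near (c1 c2 : R -> 'M[C]_n) dc :
  (\forall t \near (0 : R), c1 t = c2 t) -> cderive c1 dc -> cderive c2 dc.
Proof.
move=> h; apply: near_eq_is_derive.
by near=> t; congr real_coords; near: t.
Unshelve. all: by end_near. Qed.

Lemma cdiag_adj d : (cdiag d)^t*%sesqui = cdiag d.
Proof.
rewrite cdiag_tr map_diag_mx; congr diag_mx; apply/rowP => i; rewrite !mxE.
by apply/eqP; rewrite eq_complex /= oppr0 !eqxx.
Qed.

Definition gram_mx (X : 'M[C]_n) : 'M[C]_n := X *m X^t*%sesqui.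

Lemma cdiag_gram d :
  cdiag d *m (cdiag d)^t*%sesqui = diag_mx (map_mx (fun x => (x ^+ 2)%:C%C) d).
Proof.
rewrite cdiag_adj mulmx_diag; congr diag_mx.
by apply/rowP => i; rewrite !mxE expr2 rmorphM.
Qed.

Lemma gram_orbit (g : 'M[C]_n) d : g \is unitarymx ->
  gram_mx (g *m cdiag d *m g^T)
    = g *m diag_mx (map_mx (fun x => (x ^+ 2)%:C%C) d) *m g^t*%sesqui.
Proof.
move=> gU; apply: etrans (gram_congrmx (cdiag d) gU) _.
exact: (congr1 (fun A => g *m A *m g^t*%sesqui) (cdiag_gram d)).
Qed.

Definition horner_gram p (X : 'M[C]_n) : 'M[C]_n := horner_mx (gram_mx X) p.

Lemma horner_gram_orbit p g d : g \is unitarymx ->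
  horner_gram p (g *m cdiag d *m g^T)
    = g *m diag_mx (map_mx (fun x => p.[(x ^+ 2)%:C%C]) d) *m g^t*%sesqui.
Proof.
move=> gU; rewrite /horner_gram gram_orbit //.
apply: etrans (horner_mx_unitary_conj _ _ gU) _.
apply: (congr1 (fun A => g *m A *m g^t*%sesqui)).
rewrite horner_mx_diag; congr diag_mx.
by apply/rowP => i; rewrite !mxE.
Qed.

Lemma mxpolyfun_horner_gram p : mxpolyfun (horner_gram p \o @complex_coords R n').
Proof.
apply: mxpolyfun_horner; apply: mxpolyfunM; first exact: mxpolyfun_complex_coords.
exact/mxpolyfun_adj/mxpolyfun_complex_coords.
Qed.

Lemma one_cdiag d : 1%:M *m cdiag d *m (1%:M)^T = cdiag d.
Proof. by rewrite trmx1 mulmx1 mul1mx. Qed.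

(** * Linearized equations of an orbit at a diagonal point *)

Section AtDiagonal.
Variables (d : 'rV[R]_n) (c : R -> 'M[C]_n) (y : 'M[C]_n).
Hypothesis d_ge0 : forall i, 0 <= d 0 i.
Hypothesis c_orbit : \forall t \near (0 : R),
  exists2 g, g \is unitarymx & c t = g *m cdiag d *m g^T.
Hypothesis c0 : c 0 = cdiag d.
Hypothesis dc : cderive c y.

(** On the orbit, the value of [q k] at X X^* is a nonzero multiple of the projection onto the
    eigenspace for d_k^2. Repeated entries of d only repeat factors and change that multiple. *)
Let q k : {poly C} := \prod_(i | d 0 i != d 0 k) ('X - ((d 0 i ^+ 2)%:C%C)%:P).

Let sqr_d_inj i k : (d 0 i ^+ 2 == d 0 k ^+ 2) = (d 0 i == d 0 k).
Proof. by rewrite eqrXn2. Qed.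

Let q_root i k : d 0 i != d 0 k -> (q k).[(d 0 i ^+ 2)%:C%C] = 0.
Proof.
by move=> ik; rewrite /q horner_prod (bigD1 i) //= hornerXsubC subrr mul0r.
Qed.

Let q_neq0 i k : d 0 i = d 0 k -> (q k).[(d 0 i ^+ 2)%:C%C] != 0.
Proof.
move=> ik; rewrite /q horner_prod; apply/prodf_neq0 => l lk.
by rewrite hornerXsubC subr_eq0 (inj_eq (@complexI R)) ik eq_sym sqr_d_inj.
Qed.

(** Existence suffices: in both uses below, W is multiplied by a matrix whose k-th column vanishes
    at time 0. *)
Let dq k : exists W, cderive (horner_gram (q k) \o c) W.
Proof. eexists; exact: (polymap_cderive (mxpolyfun_horner_gram (q k)) dc). Qed.

Let horner_gram0 k : horner_gram (q k) (c 0) =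
  diag_mx (map_mx (fun x => (q k).[(x ^+ 2)%:C%C]) d).
Proof.
have U1 : (1%:M : 'M[C]_n) \is unitarymx.
  by apply/unitarymxP; rewrite trmx1 map_mx1 mulmx1.
by rewrite c0 -{1}(one_cdiag d) horner_gram_orbit // trmx1 map_mx1 mulmx1 mul1mx.
Qed.

(** Differentiating q(S) (S - d_k^2) = 0, where S = X X^*, and taking the entry (j, k) leaves
    q(d_k^2) d_k (y_jk + conj y_kj) = 0. *)
Lemma diag_tangent_re j k : d 0 j = d 0 k -> d 0 k != 0 -> Re (y j k + (y k j)^*) = 0.
Proof.
move=> jk dk0; have [W dW] := dq k.
have dS : cderive (fun t => c t *m (c t)^t*%sesqui)
    (y *m (cdiag d)^t*%sesqui + cdiag d *m y^t*%sesqui).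
  by rewrite -c0; apply: cderiveM => //; exact: cderive_adj.
pose mu : 'M[C]_n := - ((d 0 k ^+ 2)%:C%C)%:M.
have dSm := cderiveD dS (cderive_cst mu).
have := cderiveM dW dSm.
have E0 : \forall t \near (0 : R),
    (horner_gram (q k) \o c) t *m (c t *m (c t)^t*%sesqui + mu) = 0.
  near=> t; have /= [g gU ->] : exists2 g, g \is unitarymx &
    c t = g *m cdiag d *m g^T by near: t.
  rewrite horner_gram_orbit // -/(gram_mx _) gram_orbit //.
  have -> : mu = g *m diag_mx (const_mx (- (d 0 k ^+ 2)%:C%C)) *m g^t*%sesqui.
    by rewrite diag_const_mx unitary_conj_scalar /mu ?raddfN.
  rewrite -mulmxDl -mulmxDr -raddfD /= mul_unitary_conj // mulmx_diag.
  apply: mul_diag0 => i; rewrite !mxE -rmorphN -rmorphD.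
  have [ik|ik] := eqVneq (d 0 i) (d 0 k); last by rewrite q_root // mul0r.
  by rewrite ik subrr rmorph0 mulr0.
move=> /(cderive_near E0) /(cderive_unique (cderive_cst 0)).
rewrite [(_ \o c) 0]horner_gram0 c0 cdiag_adj addr0 => /matrixP/(_ j k).
rewrite mxE [X in _ = X]mxE.
have -> : (W *m (cdiag d *m cdiag d + mu)) j k = 0.
  rewrite (_ : _ + mu = diag_mx (map_mx (fun x => (x ^+ 2 - d 0 k ^+ 2)%:C%C) d)).
    by rewrite mul_mx_diag !mxE subrr rmorph0 mulr0.
  rewrite mulmx_diag /mu -diag_const_mx -raddfB; congr diag_mx.
  by apply/rowP => i; rewrite !mxE rmorphB !rmorphXn /= expr2.
rewrite add0r mul_diag_mx [X in _ = X]mxE [X in X * _]mxE.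
have -> : (y *m cdiag d + cdiag d *m y^t*%sesqui) j k
    = (d 0 k)%:C%C * (y j k + (y k j)^*).
  by rewrite mxE /cdiag mul_mx_diag mul_diag_mx !mxE jk mulrDr mulrC.
move=> /esym/eqP; rewrite mulf_eq0 (negbTE (q_neq0 jk)) /=.
rewrite mulf_eq0 => /orP[|/eqP ->//].
by rewrite eq_complex /= (negbTE dk0).
Unshelve. all: by end_near. Qed.

(** When d_k = 0 the previous relation is empty. The derivative of q(S) X = 0, with S = X X^*, gives
    q(0) y_jk = 0 instead, which kills real and imaginary parts at once. *)
Lemma diag_tangent_zero j k : d 0 j = 0 -> d 0 k = 0 -> y j k = 0.
Proof.
move=> j0 k0; have jk : d 0 j = d 0 k by rewrite j0 k0.
have [W dW] := dq k; have := cderiveM dW dc.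
have E0 : \forall t \near (0 : R), (horner_gram (q k) \o c) t *m c t = 0.
  near=> t; have /= [g gU ->] : exists2 g, g \is unitarymx &
    c t = g *m cdiag d *m g^T by near: t.
  rewrite horner_gram_orbit // mul_unitary_congr // mulmx_diag.
  apply: mul_diag0 => i; rewrite !mxE.
  have [ik|ik] := eqVneq (d 0 i) (d 0 k); last by rewrite q_root // mul0r.
  by rewrite ik k0 mulr0.
move=> /(cderive_near E0) /(cderive_unique (cderive_cst 0)).
rewrite [(_ \o c) 0]horner_gram0 c0 => /matrixP/(_ j k).
rewrite mxE [X in _ = X]mxE mul_mx_diag mul_diag_mx !mxE k0 rmorph0 mulr0 add0r.
by move=> /esym/eqP; rewrite mulf_eq0 (negbTE (q_neq0 jk)) /= => /eqP.
Unshelve. all: by end_near. Qed.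

Lemma diag_tangent_sym : y^T = y.
Proof.
apply: (cderive_unique (cderive_tr dc)); apply: cderive_near dc.
near=> t; have /= [g gU ->] : exists2 g, g \is unitarymx &
    c t = g *m cdiag d *m g^T by near: t.
by rewrite (sym_conj_cdiag g d).
Unshelve. all: by end_near. Qed.

Lemma diag_tangent_re0 j k : d 0 j = d 0 k -> Re (y j k) = 0.
Proof.
move=> jk; have [k0|k0] := eqVneq (d 0 k) 0.
  by rewrite diag_tangent_zero ?jk.
have := diag_tangent_re jk k0; rewrite -{2}diag_tangent_sym mxE.
by case: (y j k) => a b /= /eqP; rewrite -mulr2n mulrn_eq0 => /eqP.
Qed.

Definition tangent_coef (z : 'M[C]_n) j k : R :=
  if (j < k)%N then Re (z j k) else Im (z j k).

(** If d_k - d_j vanishes, the real part of the entry is 0. If d_j + d_k vanishes, nonnegativity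
    forces d_j = d_k = 0, where the whole entry is 0. *)
Lemma tangent_coef_root j k : root_val d j k = 0 -> tangent_coef y j k = 0.
Proof.
rewrite /root_val /tangent_coef; case: ltnP => _.
  by move=> /eqP; rewrite subr_eq0 => /eqP kj; rewrite diag_tangent_re0.
move=> /eqP; rewrite paddr_eq0 // => /andP[/eqP j0 /eqP k0].
by rewrite diag_tangent_zero.
Qed.

End AtDiagonal.

Lemma tangent_gen_entry j k a b : tangent_gen R j k a b =
  (if (j < k)%N then 1 else 'i%C) * ((a == j) && (b == k))%:R +
  (if (j < k)%N then 1 else if j == k then 0 else 'i%C) * ((a == k) && (b == j))%:R.
Proof.
rewrite /tangent_gen /skew_gen; case: ltnP => _; last case: (j =P k) => [<-|_].
- by rewrite !mxE !mul1r.
- by rewrite !mxE mul0r addr0.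
- by rewrite !mxE mulrDr.
Qed.

Lemma tangent_sum_entry (b : 'I_n -> 'I_n -> R) p q :
  (\sum_j \sum_k (b j k)%:C%C *: tangent_gen R j k) p q =
  (b p q)%:C%C * (if (p < q)%N then 1 else 'i%C) +
  (b q p)%:C%C * (if (q < p)%N then 1 else if q == p then 0 else 'i%C).
Proof.
have S (f : 'I_n -> 'I_n -> C) a c :
    \sum_j \sum_k f j k * ((a == j) && (c == k))%:R = f a c.
  rewrite (bigD1 a) //= (bigD1 c) //= !eqxx mulr1 !big1 ?addr0 //.
    by move=> j /negbTE ja; rewrite big1 // => k _; rewrite eq_sym ja mulr0.
  by move=> k /negbTE kc; rewrite [c == k]eq_sym kc mulr0.
rewrite summxE; under eq_bigr => j _.
  rewrite summxE.
  under eq_bigr => k _ do rewrite mxE tangent_gen_entry mulrDr !mulrA.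
  rewrite big_split; over.
rewrite big_split /= S; congr (_ + _).
under eq_bigr => j _ do under eq_bigr => k _ do rewrite andbC.
by rewrite S.
Qed.

(** For j different from k, the generators of (j, k) and (k, j) occupy the same entries, but one is
    real and the other imaginary, so their coefficients separate. *)
Lemma tangent_sum_eq0 (b : 'I_n -> 'I_n -> R) :
  \sum_j \sum_k (b j k)%:C%C *: tangent_gen R j k = 0 -> forall j k, b j k = 0.
Proof.
move=> /matrixP h j k; have := h j k; have := h k j; rewrite !tangent_sum_entry !mxE.
rewrite [k == j]eq_sym; case: (ltngtP j k) => [jk|jk|/val_inj <-].
- rewrite -(inj_eq val_inj) (ltn_eqF jk) => _ [].
  by rewrite !(mul0r, mulr0, mulr1, oppr0, addr0, add0r).
- move=> _ [].
  by rewrite !(mul0r, mulr0, mulr1, oppr0, addr0, add0r).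
- by rewrite eqxx => [[_]] []; rewrite !(mul0r, mulr0, mulr1, oppr0, addr0, add0r).
Qed.

Lemma tangent_coefP (z : 'M[C]_n) : z^T = z -> (forall j, Re (z j j) = 0) ->
  z = \sum_j \sum_k (tangent_coef z j k)%:C%C *: tangent_gen R j k.
Proof.
move=> zT z0; apply/matrixP => j k; rewrite tangent_sum_entry /tangent_coef.
have -> : z k j = z j k by rewrite -{1}zT mxE.
have := z0 j; rewrite [k == j]eq_sym; case: (ltngtP j k) => [jk|jk|/val_inj <-].
- rewrite -(inj_eq val_inj) (ltn_eqF jk) => _; case: (z j k) => a b.
  by apply/eqP; rewrite eq_complex /= !(mul0r, mulr0, mulr1, oppr0, addr0, add0r) !eqxx.
- move=> _; case: (z j k) => a b.
  by apply/eqP; rewrite eq_complex /= !(mul0r, mulr0, mulr1, oppr0, addr0, add0r) !eqxx.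
- rewrite eqxx; case: (z j j) => a b /= ->.
  by apply/eqP; rewrite eq_complex /= !(mul0r, mulr0, mulr1, oppr0, addr0, add0r) !eqxx.
Qed.

(** Conjugation by u^* moves the curve to the diagonal point. The orbit condition is local in t
    because a line through a point of the open cube stays inside it only for small t. *)
Lemma orbit_tangent (u : 'M[C]_n) d c dc :
  u \is unitarymx -> (forall i, 0 <= d 0 i) ->
  (\forall t \near (0 : R), Defs.orbit (u *m cdiag d *m u^T) (c t)) ->
  c 0 = u *m cdiag d *m u^T -> cderive c dc ->
  exists b : 'I_n -> 'I_n -> R, (forall j k, root_val d j k = 0 -> b j k = 0) /\
    dc = \sum_j \sum_k (b j k)%:C%C *: (u *m tangent_gen R j k *m u^T).
Proof.
move=> uU d_ge0 c_orb c0 dcc.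
pose v : 'M[C]_n := u^t*%sesqui.
have vU : v \is unitarymx by exact: unitarycJ.
have dcv := cderive_mulr v v^T dcc.
set y := v *m dc *m v^T in dcv.
have cv_orb : \forall t \near (0 : R), exists2 g, g \is unitarymx &
    v *m c t *m v^T = g *m cdiag d *m g^T.
  near=> t; have /(orbit_cdiagP _ _ uU)[g gU ->] :
    Defs.orbit (u *m cdiag d *m u^T) (c t) by near: t.
  by exists (v *m g); [exact: (unitarycM vU gU)|exact: congrmxM].
have cv0 : v *m c 0 *m v^T = cdiag d.
  by rewrite c0; exact: (congrmx_unitaryK (cdiag d) uU).
exists (tangent_coef y); split.
  by move=> j k; apply: tangent_coef_root cv_orb cv0 dcv _ _.
have -> : dc = u *m y *m u^T by exact: (esym (congrmx_unitaryVK dc uU)).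
rewrite {1}(tangent_coefP (diag_tangent_sym cv_orb dcv)); last first.
  by move=> j; apply: diag_tangent_re0 cv_orb cv0 dcv _ _ _.
rewrite mulmx_sumr mulmx_suml; apply: eq_bigr => j _.
rewrite mulmx_sumr mulmx_suml; apply: eq_bigr => k _.
by rewrite -scalemxAr -scalemxAl.
Unshelve. all: by end_near. Qed.

End TangentVectors.

Section OrbitDimension.
Variables (R : realType) (n' : nat).
Local Notation n := n'.+1.
Local Notation N := (n * n + n * n)%N.
Local Notation C := R[i].
Implicit Types (u : 'M[C]_n) (d : 'rV[R]_n) (i : 'I_(n * n)).

Definition index_pair i : 'I_n * 'I_n := enum_val (cast_ord (esym (mxvec_cast n n)) i).

Lemma index_pairK j k : index_pair (mxvec_index j k) = (j, k).
Proof. by rewrite /index_pair /mxvec_index cast_ordK enum_rankK. Qed.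

Definition tangent_mx u : 'M[R]_(n * n, N) := \matrix_(i < n * n)
  real_coords (u *m tangent_gen R (index_pair i).1 (index_pair i).2 *m u^T).

Definition root_row d : 'rV[R]_(n * n) :=
  \row_i root_val d (index_pair i).1 (index_pair i).2.

Lemma mul_tangent_mx u (b : 'rV[R]_(n * n)) : b *m tangent_mx u =
  real_coords (\sum_j \sum_k (b 0 (mxvec_index j k))%:C%C *: (u *m tangent_gen R j k *m u^T)).
Proof.
rewrite mulmx_sum_row (reindex _ (curry_mxvec_bij n n)) /=.
rewrite real_coords_sum.
under [RHS]eq_bigr => j _ do rewrite real_coords_sum.
rewrite pair_bigA; apply: eq_bigr => -[j k] _ /=.
by rewrite real_coordsZ rowK index_pairK.
Qed.

Lemma sum_congr_tangent u (b : 'I_n -> 'I_n -> R) :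
  \sum_j \sum_k (b j k)%:C%C *: (u *m tangent_gen R j k *m u^T) =
  u *m (\sum_j \sum_k (b j k)%:C%C *: tangent_gen R j k) *m u^T.
Proof.
rewrite mulmx_sumr mulmx_suml; apply: eq_bigr => j _.
rewrite mulmx_sumr mulmx_suml; apply: eq_bigr => k _.
exact: (esym (congrmxZ u _ _)).
Qed.

Lemma tangent_mx_free u : u \is unitarymx -> row_free (tangent_mx u).
Proof.
move=> uU; apply: inj_row_free => v; rewrite mul_tangent_mx sum_congr_tangent.
rewrite -real_coords0 => /real_coords_inj h.
have S0 : \sum_j \sum_k (v 0 (mxvec_index j k))%:C%C *: tangent_gen R j k = 0.
  by rewrite -(congrmx_unitaryK (\sum_j _) uU) h mulmx0 mul0mx.
apply/rowP; case/mxvec_indexP => j k; rewrite mxE.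
exact: (tangent_sum_eq0 (b := fun j k => v 0 (mxvec_index j k)) S0).
Qed.

Lemma tangent_vector_rows u d (y : 'rV[R]_N) :
  u \is unitarymx -> (forall j, 0 <= d 0 j) ->
  forall c : R -> 'rV[R]_N,
  (\forall t \near (0 : R),
     (@real_coords R n @` Defs.orbit (u *m cdiag d *m u^T))%classic (c t)) ->
  c 0 = real_coords (u *m cdiag d *m u^T) ->
  is_derive (0 : R) (1 : R) c y ->
  exists b : 'rV[R]_(n * n), y = b *m tangent_mx u /\
    forall i, root_row d 0 i = 0 -> b 0 i = 0.
Proof.
move=> uU d_ge0 c c_orb c0 dc.
have cK : (fun t => real_coords (complex_coords (c t))) = c.
  by apply/funext => t; rewrite complex_coordsK.
have [b [b0 dy]] : exists b : 'I_n -> 'I_n -> R,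
    (forall j k, root_val d j k = 0 -> b j k = 0) /\
    complex_coords y = \sum_j \sum_k (b j k)%:C%C *: (u *m tangent_gen R j k *m u^T).
  apply: (@orbit_tangent _ _ u d (fun t => complex_coords (c t))).
  - exact: uU.
  - exact: d_ge0.
  - near=> t; have [X XO <-] :
      (@real_coords R n @` Defs.orbit (u *m cdiag d *m u^T))%classic (c t) by near: t.
    by rewrite real_coordsK.
  - by rewrite c0 real_coordsK.
  - by rewrite /cderive complex_coordsK cK.
exists (\row_i b (index_pair i).1 (index_pair i).2); split.
  rewrite mul_tangent_mx -[LHS]complex_coordsK dy; congr real_coords.
  by apply: eq_bigr => j _; apply: eq_bigr => k _; rewrite mxE index_pairK.
by move=> i; rewrite !mxE => /b0.
Unshelve. all: by end_near. Qed.

Definition diag_point u d : 'M[C]_n := u *m cdiag d *m u^T.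

Definition orbit_coords u d : set 'rV[R]_N :=
  (@real_coords R n @` Defs.orbit (diag_point u d))%classic.

Lemma tangent_vector_sub u d y : u \is unitarymx -> (forall j, 0 <= d 0 j) ->
  tangent_vector (orbit_coords u d) (real_coords (diag_point u d)) y ->
  exists b : 'rV[R]_(n * n), y = b *m tangent_mx u /\
    forall i, root_row d 0 i = 0 -> b 0 i = 0.
Proof.
move=> uU d_ge0 [c [c_orb c0 dc]].
by apply: (tangent_vector_rows uU d_ge0 _ c0 dc); near=> t; exact: c_orb.
Unshelve. all: by end_near. Qed.

Lemma tangent_vector_row u d i : u \is unitarymx ->
  tangent_vector (orbit_coords u d) (real_coords (diag_point u d))
    (row i (diag_mx (root_row d) *m tangent_mx u)).
Proof.
move=> uU; pose j := (index_pair i).1; pose k := (index_pair i).2.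
exists (fun t => real_coords (orbit_curve u j k d t)); split.
- by move=> t; exists (orbit_curve u j k d t) => //; exact: orbit_curve_orbit.
- by rewrite orbit_curve0.
have -> : row i (diag_mx (root_row d) *m tangent_mx u) =
    real_coords ((root_val d j k)%:C%C *: (u *m tangent_gen R j k *m u^T)).
  by rewrite real_coordsZ row_mul row_diag_mx -scalemxAl -rowE rowK mxE.
exact: cderive_orbit_curve.
Qed.

Lemma scaled_tangent_mx_free u d : u \is unitarymx -> (forall i, root_row d 0 i != 0) ->
  row_free (diag_mx (root_row d) *m tangent_mx u).
Proof.
move=> uU r0; rewrite /row_free mxrankMfree ?tangent_mx_free //.
rewrite -/(row_free _) row_free_unit unitmxE det_diag unitfE.
by apply/prodf_neq0 => i _.
Qed.

Lemma orbit_dim_le u d : u \is unitarymx -> (forall j, 0 <= d 0 j) ->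
  (orbit_dim (diag_point u d) <= n * n)%N.
Proof.
move=> uU d_ge0; apply/bigmax_leqP => m /asboolP[A [Afree tA]].
rewrite -(eqP Afree); apply: leq_trans (rank_leq_row (tangent_mx u)).
apply/mxrankS/row_subP => i.
by have [b [-> _]] := tangent_vector_sub uU d_ge0 (tA i); exact: submxMl.
Qed.

Lemma orbit_dim_regular u d : u \is unitarymx -> (forall j, 0 <= d 0 j) ->
  (forall i, root_row d 0 i != 0) -> orbit_dim (diag_point u d) = (n * n)%N.
Proof.
move=> uU d_ge0 r0; apply/eqP; rewrite eqn_leq orbit_dim_le //=.
(* The maximum in [dim_at] is taken up to the ambient dimension N = 2 n^2, so n * n is a
   candidate. *)
have nN : (n * n < N.+1)%N by rewrite ltnS leq_addr.
apply: (@leq_bigmax_cond _ _ (fun m : 'I_N.+1 => m : nat) (Ordinal nN)).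
apply/asboolP; exists (diag_mx (root_row d) *m tangent_mx u); split.
  exact: scaled_tangent_mx_free.
by move=> i; exact: tangent_vector_row.
Qed.

(** The coefficient at the vanishing root is always 0, so the tangent vectors lie in the span of the
    other n * n - 1 rows. *)
Lemma orbit_dim_singular u d i0 : u \is unitarymx -> (forall j, 0 <= d 0 j) ->
  root_row d 0 i0 = 0 -> (orbit_dim (diag_point u d) < n * n)%N.
Proof.
move=> uU d_ge0 r0; rewrite -(prednK (_ : 0 < n * n)%N) // ltnS.
apply/bigmax_leqP => m /asboolP[A [Afree tA]].
rewrite -(eqP Afree); apply: leq_trans (rank_leq_row (row' i0 (tangent_mx u))).
apply/mxrankS/row_subP => i.
have [b [-> b0]] := tangent_vector_sub uU d_ge0 (tA i).
rewrite mulmx_sum_row; apply: summx_sub => k _.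
have [->|ki] := eqVneq k i0; first by rewrite b0 // scale0r sub0mx.
apply: scalemx_sub; case: (unliftP i0 k) ki => [l ->|->]; last by rewrite eqxx.
move=> _; apply: (eq_row_sub l).
by apply/rowP => c; rewrite !mxE.
Qed.

End OrbitDimension.

(** * Stabilizers of the regular points *)

Section SignGroup.
Variables (C : numClosedFieldType) (n : nat).
Implicit Types (u h X : 'M[C]_n) (a : 'rV[C]_n) (e : {ffun 'I_n -> bool}).

Definition sign_mx e : 'M[C]_n := diag_mx (\row_i (-1) ^+ e i).

Lemma sign_mx_unitary e : sign_mx e \is unitarymx.
Proof.
apply/unitarymxP; rewrite tr_diag_mx map_diag_mx mulmx_diag -diag_const_mx.
congr diag_mx; apply/rowP => i; rewrite !mxE rmorphXn /= rmorphN rmorph1.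
by rewrite -exprD addnn -mul2n exprM sqrrN expr1n expr1n.
Qed.

Lemma sign_mx_diag e a : sign_mx e *m diag_mx a *m (sign_mx e)^T = diag_mx a.
Proof.
rewrite tr_diag_mx !mulmx_diag; congr diag_mx; apply/rowP => i; rewrite !mxE.
by rewrite mulrAC -exprD addnn -mul2n exprM sqrrN expr1n expr1n mul1r.
Qed.

Lemma sign_mx_inj : injective sign_mx.
Proof.
move=> e e' /matrixP h; apply/ffunP => i; have := h i i.
by rewrite !mxE eqxx !mulr1n => /signr_inj.
Qed.

(** Unitarity of h^t gives h D = D conj h. Comparing moduli, h_jk = 0 whenever a_j and a_k differ;
    on the diagonal h_jj is real, and unitarity makes it 1 or -1. *)
Lemma diag_stabilizer h a : h \is unitarymx ->
  (forall i, 0 < a 0 i) -> injective (a 0) ->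
  h *m diag_mx a *m h^T = diag_mx a -> exists e, h = sign_mx e.
Proof.
move=> hU a0 aI hX; have hTU : h^T \is unitarymx by rewrite trmx_unitary.
have hD : h *m diag_mx a = diag_mx a *m (h^T)^t*%sesqui.
  by rewrite -[X in _ = X *m _]hX mulmxtVK.
have hE j k : h j k * a 0 k = a 0 j * (h j k)^*.
  by move/matrixP/(_ j k): hD; rewrite mul_mx_diag mul_diag_mx !mxE.
have h0 j k : j != k -> h j k = 0.
  apply: contraNeq => hjk; apply/eqP/aI.
  have := congr1 Num.norm (hE j k); rewrite !normrM norm_conjC mulrC.
  rewrite (ger0_norm (ltW (a0 j))) (ger0_norm (ltW (a0 k))) => /(mulIf _) -> //.
  by rewrite normr_eq0.
have hr j : (h j j)^* = h j j.
  by have := hE j j; rewrite mulrC => /(mulfI (lt0r_neq0 (a0 j))) /esym.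
have h1 j : (h j j == 1) || (h j j == -1).
  rewrite -eqf_sqr expr1n; have /matrixP/(_ j j) := unitarymxP hU.
  rewrite !mxE (bigD1 j) //= big1 ?addr0 => [|k kj]; last first.
    by rewrite h0 1?eq_sym // mul0r.
  by rewrite !mxE hr eqxx expr2 => ->.
exists [ffun j => h j j == -1]; apply/matrixP => j k; rewrite !mxE ffunE.
have [->|jk] := eqVneq j k; last by rewrite h0 // mulr0n.
rewrite mulr1n; case: eqP => [->|/eqP hk]; first by rewrite expr1.
by move: (h1 k); rewrite (negbTE hk) orbF => /eqP ->; rewrite expr0.
Qed.

Lemma congr_stabilizer u g X : u \is unitarymx -> g \is unitarymx ->
  g *m (u *m X *m u^T) *m g^T = u *m X *m u^T ->
  (u^t*%sesqui *m g *m u) *m X *m (u^t*%sesqui *m g *m u)^T = X.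
Proof.
move=> uU gU h; rewrite -[RHS](congrmx_unitaryK X uU) -[in RHS]h.
by rewrite !congrmxM ?mulmxA.
Qed.

Lemma conj_sign_stab u e a : u \is unitarymx ->
  (u *m sign_mx e *m u^t*%sesqui) *m (u *m diag_mx a *m u^T)
    *m (u *m sign_mx e *m u^t*%sesqui)^T = u *m diag_mx a *m u^T.
Proof.
move=> uU; have E : u *m sign_mx e *m u^t*%sesqui *m u = u *m sign_mx e.
  by rewrite -mulmxA (mulmx1C (unitarymxP uU)) mulmx1.
by rewrite congrmxM E -congrmxM sign_mx_diag.
Qed.

Lemma unitary_conjK u g : u \is unitarymx ->
  g = u *m (u^t*%sesqui *m g *m u) *m u^t*%sesqui.
Proof.
move=> uU; rewrite !mulmxA (unitarymxP uU) mul1mx -mulmxA (unitarymxP uU).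
by rewrite mulmx1.
Qed.

Lemma conj_sign_inj u : u \is unitarymx ->
  injective (fun e => u *m sign_mx e *m u^t*%sesqui).
Proof.
move=> uU e e' /(congr1 (fun A => u^t*%sesqui *m A *m u)).
rewrite !mulmxA (mulmx1C (unitarymxP uU)) !mul1mx -!mulmxA (mulmx1C (unitarymxP uU)).
by rewrite !mulmx1 => /sign_mx_inj.
Qed.

Lemma conj_sign_unitary u e : u \is unitarymx ->
  u *m sign_mx e *m u^t*%sesqui \is unitarymx.
Proof. by move=> uU; rewrite !mul_unitarymx ?trmxC_unitary ?sign_mx_unitary. Qed.

End SignGroup.

(** In a connected B with x in B and B inside A, the point x is closed, and also open because A
    minus x is finite, hence closed. *)
Lemma connected_component_finite (T : topologicalType) (A : set T) x :
  hausdorff_space T -> finite_set A -> A x -> connected_component A x = [set x]%classic.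
Proof.
move=> hT fA Ax; apply/seteqP; split; last by move=> _ ->; exact: connected_component_refl.
move=> y [B [Bx BA cB] By].
have acc := hausdorff_accessible hT.
suff -> : [set x]%classic = B by [].
apply: cB; first by exists x.
- exists (~` (A `\ x))%classic.
    apply: closed_openC; apply: accessible_finite_set_closed.1 acc _ _.
    exact: finite_setD.
  apply/seteqP; split=> [_ ->|z [Bz nz]]; first by split => // -[_]; apply.
  by apply: contrapT => zx; apply: nz; split=> //; exact: BA.
- exists [set x]%classic; first exact: accessible_closed_set1.
  by apply/seteqP; split=> [_ -> //|z []].
Qed.

Section RegularPoints.
Variables (R : realType) (n' : nat).
Local Notation n := n'.+1.
Local Notation N := (n * n + n * n)%N.
Local Notation C := R[i].
Implicit Types (u X Y : 'M[C]_n) (d : 'rV[R]_n).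

Lemma takagi_real X : sym_matrix X ->
  exists u d, [/\ u \is unitarymx, forall i, 0 <= d 0 i & X = diag_point u d].
Proof.
move=> /takagi[u [a [uU a0 XE]]]; exists u, (map_mx (@complex.Re R) a).
have aE : map_mx (real_complex R) (map_mx (@complex.Re R) a) = a.
  by apply/rowP => i; rewrite !mxE; apply/RRe_real/ger0_real.
split; first exact: uU.
  by move=> i; rewrite mxE; move: (a0 i); rewrite lecE => /andP[].
by rewrite /diag_point /cdiag aE; exact: XE.
Qed.

(** The point (1, ..., n), where no root vanishes: it shows that the maximal orbit dimension is n *
    n, and its orbit is the reference for volumes. *)
Definition ref_diag : 'rV[R]_n := \row_i (i.+1)%:R.

Lemma ref_diag_ge0 i : 0 <= ref_diag 0 i.
Proof. by rewrite mxE. Qed.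

Lemma root_row_ref i : root_row ref_diag 0 i != 0.
Proof.
rewrite mxE /root_val !mxE; case: ltnP => h.
  by rewrite subr_eq0 eqr_nat eqSS gtn_eqF.
by rewrite -natrD pnatr_eq0 addSn.
Qed.

Lemma unitary1 : (1%:M : 'M[C]_n) \is unitarymx.
Proof. by apply/unitarymxP; rewrite trmx1 map_mx1 mulmx1. Qed.

Lemma regularP u d : u \is unitarymx -> (forall i, 0 <= d 0 i) ->
  regular (diag_point u d) <-> forall i, root_row d 0 i != 0.
Proof.
move=> uU d_ge0; split=> [[_ h] i|r0].
  apply/eqP => ri0; have := h (diag_point 1%:M ref_diag) (sym_conj_cdiag _ _).
  rewrite (orbit_dim_regular unitary1 ref_diag_ge0 root_row_ref).
  by rewrite leqNgt (orbit_dim_singular uU d_ge0 ri0).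
split; first exact: sym_conj_cdiag.
move=> Y /takagi_real[v [e [vU e_ge0 ->]]].
by rewrite (orbit_dim_regular uU d_ge0 r0) orbit_dim_le.
Qed.

Lemma root_row_neq0 d : (forall i, 0 <= d 0 i) -> (forall i, root_row d 0 i != 0) ->
  (forall j, 0 < d 0 j) /\ injective (d 0).
Proof.
move=> d_ge0 r0; have r j k : root_val d j k != 0.
  by have := r0 (mxvec_index j k); rewrite mxE index_pairK.
split=> [j|j k djk].
  rewrite lt0r d_ge0 andbT; apply: contra (r j j) => /eqP dj.
  by rewrite /root_val ltnn dj addr0.
case: (ltngtP j k) => [h|h|/val_inj //].
  by have := r j k; rewrite /root_val h djk subrr eqxx.
by have := r k j; rewrite /root_val h djk subrr eqxx.
Qed.

Definition conj_sign u (e : {ffun 'I_n -> bool}) : 'M[C]_n :=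
  u *m sign_mx C e *m u^t*%sesqui.

Lemma sym_act_stabP u d g : u \is unitarymx -> g \is unitarymx ->
  sym_act g (diag_point u d) = diag_point u d ->
  (u^t*%sesqui *m g *m u) *m cdiag d *m (u^t*%sesqui *m g *m u)^T = cdiag d.
Proof.
move=> uU gU.
exact: (@congr_stabilizer _ n u g (cdiag d) uU gU).
Qed.

Lemma sym_act_sign u d e : u \is unitarymx ->
  sym_act (conj_sign u e) (diag_point u d) = diag_point u d.
Proof.
move=> uU.
exact: (@conj_sign_stab _ n u e (map_mx (real_complex R) d) uU).
Qed.

Lemma conj_signU u e : u \is unitarymx -> conj_sign u e \is unitarymx.
Proof.
move=> uU. exact: (@conj_sign_unitary _ n u e uU).
Qed.

Lemma conj_sign_ex u d g : u \is unitarymx -> g \is unitarymx ->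
 (forall j, 0 < d 0 j) -> injective (d 0) ->
 sym_act g (diag_point u d) = diag_point u d -> exists e, g = conj_sign u e.
Proof.
move=> uU gU d0 dI gX.
have [||||e he] := @diag_stabilizer _ n (u^t*%sesqui *m g *m u) (map_mx (real_complex R) d).
exact: (unitarycM (unitarycM (unitarycJ uU) gU) uU).
by move=> i; rewrite mxE ltcR.
by move=> j k; rewrite !mxE => /complexI/dI.
exact: (sym_act_stabP uU gU gX).
exists e. 
rewrite /conj_sign -he.
exact: (@unitary_conjK _ n u g uU).
Qed.

Lemma stabilizer_regular u d : u \is unitarymx -> (forall i, 0 <= d 0 i) ->
  (forall i, root_row d 0 i != 0) ->
  stabilizer (diag_point u d) = range (conj_sign u).
Proof.
move=> uU d_ge0 r0; have [d0 dI] := root_row_neq0 d_ge0 r0.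
apply/seteqP; split=> [g [gU gX]|_ [e _ <-]]; last first.
  by split; [exact: conj_signU|exact: sym_act_sign].
have [e ->] := conj_sign_ex uU gU d0 dI gX.
by exists e.
Qed.

(** The stabilizer is finite, so its components are its points: 2^n of them at every regular point,
    which makes all regular points principal. *)
Lemma components_regular u d : u \is unitarymx -> (forall i, 0 <= d 0 i) ->
  (forall i, root_row d 0 i != 0) ->
  (components (stabilizer (diag_point u d)) #= [set: {ffun 'I_n -> bool}])%card.
Proof.
move=> uU d_ge0 r0; rewrite (stabilizer_regular uU d_ge0 r0) /components.
set S := (@real_coords R n @` _)%classic.
have fS : finite_set S by do 2!apply: finite_image; exact: finite_finset.
have Se e : S (real_coords (conj_sign u e)).
  by exists (conj_sign u e); [exists e|].
have compE e : connected_component S (real_coords (conj_sign u e))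
    = [set real_coords (conj_sign u e)]%classic.
  exact: (connected_component_finite (@norm_hausdorff _ _) fS (Se e)).
have -> : (connected_component S @` S =
    (fun e => [set real_coords (conj_sign u e)]) @` [set: {ffun 'I_n -> bool}])%classic.
  apply/seteqP; split=> [_ [_ [_ [e _ <-] <-] <-]|_ [e _ <-]].
    by exists e; [|rewrite compE].
  by exists (real_coords (conj_sign u e)); [exact: Se|exact: compE].
apply: inj_card_eq => e e' _ _ /seteqP[+ _] => /(_ _ erefl) /real_coords_inj.
exact: conj_sign_inj.
Qed.

Lemma regular_principal X : regular X -> principal X.
Proof.
move=> rX; split=> // Y rY.
have [u [d [uU d_ge0 XE]]] := takagi_real rX.1.
have [v [e [vU e_ge0 YE]]] := takagi_real rY.1.
move: rX rY; rewrite XE YE => /(regularP uU d_ge0) rd /(regularP vU e_ge0) re.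
have hX := components_regular uU d_ge0 rd.
have hY := components_regular vU e_ge0 re.
by have := card_eq_trans hX (etrans (card_eq_sym _ _) hY); rewrite card_eq_le => /andP[].
Qed.

Lemma stabilizerM X g h : stabilizer X g -> stabilizer X h -> stabilizer X (g *m h).
Proof.
move=> [gU gX] [hU hX]; split; first exact: (unitarycM gU hU).
by rewrite -[RHS]gX -[in RHS]hX; exact/esym/congrmxM.
Qed.

Lemma stabilizerV X g : stabilizer X g -> stabilizer X (g^t*%sesqui).
Proof.
move=> [gU gX]; split; first exact: (unitarycJ gU).
by rewrite -[in LHS]gX; exact: congrmx_unitaryK.
Qed.

Lemma left_cosets_self X :
  left_cosets (stabilizer X) (stabilizer X) = [set stabilizer X]%classic.
Proof.
have gS g : stabilizer X g -> [set g *m h | h in stabilizer X]%classic = stabilizer X.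
  move=> gX; apply/seteqP; split=> [_ [h hX <-]|h hX]; first exact: stabilizerM.
  exists (g^t*%sesqui *m h); first exact/stabilizerM/hX/stabilizerV.
  by rewrite mulmxA (unitarymxP gX.1) mul1mx.
have S1 : stabilizer X 1%:M.
  split; first exact: unitary1.
  by rewrite /sym_act trmx1 mulmx1 mul1mx.
apply/seteqP; split=> [_ [g gX <-]|_ ->]; first exact: gS.
by exists 1%:M => //; exact: gS.
Qed.

(** Both stabilizers are indexed bijectively by sign vectors, and an injection of a finite set into
    itself is onto. *)
Lemma stabilizer_sub_eq X Y : regular X -> regular Y ->
  (stabilizer Y `<=` stabilizer X)%classic -> stabilizer Y = stabilizer X.
Proof.
move=> rX rY.
have [u [d [uU d_ge0 XE]]] := takagi_real rX.1.
have [v [e [vU e_ge0 YE]]] := takagi_real rY.1.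
move: rX rY; rewrite XE YE => /(regularP uU d_ge0) rd /(regularP vU e_ge0) re.
rewrite (stabilizer_regular uU d_ge0 rd) (stabilizer_regular vU e_ge0 re) => sub.
have f_ex s : exists s', conj_sign u s' = conj_sign v s.
  by have [|s' _ h] := sub (conj_sign v s); [exists s|exists s'].
have [f fE] := choice f_ex.
have fI : injective f.
  by move=> s s' ff; apply: (conj_sign_inj vU); rewrite /= -/(conj_sign v s) -fE ff fE.
apply/seteqP; split=> // _ [s _ <-].
by exists (invF fI s) => //; rewrite -fE f_invF.
Qed.

(** The candidates for the index form exactly {1}: X itself provides 1, and any regular stabilizer
    included in that of X equals it, leaving a single coset. *)
Lemma covering_index_regular X : regular X -> covering_index X = 1%N.
Proof.
move=> rX; apply: xget_unique => [|k [Y [[rY _] YX]]].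
  exists X; split; [exact: regular_principal|by []|].
  by rewrite left_cosets_self card_set1.
rewrite (stabilizer_sub_eq rX rY YX) left_cosets_self => h.
have := card_eq_trans (etrans (card_eq_sym _ _) (@card_set1 _ (stabilizer X))) h.
by move/card_eq_II.
Qed.

End RegularPoints.

(** * Volume of the orbits *)

Section VolumeScaling.
Variable R : realType.
Local Open Scope ereal_scope.
Import HBNNSimple.

(** The lower integral by simple functions, whose scaling follows by rescaling the simple
    functions. *)
Definition nnintegral d (T : measurableType d) (mu : {measure set T -> \bar R})
    (f : T -> \bar R) : \bar R :=
  ereal_sup [set sintegral mu h | h in
    [set h : {nnsfun T >-> R} | forall x, (h x)%:E <= f x]]%classic.

Lemma ge0_integral_nnintegral d (T : measurableType d) (mu : {measure set T -> \bar R})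
    (D : set T) (f : T -> \bar R) : (forall x, D x -> 0 <= f x) ->
  \int[mu]_(x in D) f x = nnintegral mu (f \_ D).
Proof. exact: ge0_integralE. Qed.

Lemma nnintegral_scale_le d (T : measurableType d) (mu : {measure set T -> \bar R})
    (f : T -> \bar R) (k : R) : (0 < k)%R ->
  k%:E * nnintegral mu f <= nnintegral mu (fun x => k%:E * f x).
Proof.
move=> k0; rewrite -lee_pdivlMl //; apply: ge_ereal_sup => _ [h hf <-].
rewrite lee_pdivlMl // -sintegralrM; apply: ereal_sup_ubound.
exists (scale_nnsfun h (ltW k0)) => // x /=.
by rewrite EFinM lee_pmul2l.
Qed.

Lemma nnintegral_scale d (T : measurableType d) (mu : {measure set T -> \bar R})
    (f : T -> \bar R) (k : R) : (0 < k)%R ->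
  nnintegral mu (fun x => k%:E * f x) = k%:E * nnintegral mu f.
Proof.
move=> k0; apply/eqP; rewrite eq_le nnintegral_scale_le // andbT.
rewrite -lee_pdivrMl //; have kV0 : (0 < k^-1)%R by rewrite invr_gt0.
apply: le_trans (nnintegral_scale_le _ _ kV0) _.
have -> // : (fun x => k^-1%:E * (k%:E * f x)) = f.
by apply/funext => x; rewrite muleA -EFinM mulVf ?gt_eqF // mul1e.
Qed.

(* ge0_integralZl asks for f to be measurable, which is not at hand for the inner
   integrals of cube_integral. *)
Lemma integral_scale d (T : measurableType d) (mu : {measure set T -> \bar R})
    (D : set T) (f : T -> \bar R) (k : R) : (0 < k)%R -> (forall x, D x -> 0 <= f x) ->
  \int[mu]_(x in D) (k%:E * f x) = k%:E * \int[mu]_(x in D) f x.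
Proof.
move=> k0 f0; rewrite !ge0_integral_nnintegral //; last first.
  by move=> x Dx; apply: mule_ge0; [rewrite lee_fin ltW|exact: f0].
rewrite -nnintegral_scale //; congr nnintegral; apply/funext => x.
by rewrite /patch; case: ifP => _ //; rewrite mule0.
Qed.

Lemma cube_integral_ge0 d (f : 'rV[R]_d -> \bar R) :
  (forall u, @open_cube R d u -> 0 <= f u) -> 0 <= cube_integral f.
Proof.
elim: d f => [|d IHd] f f0 /=; first by apply: f0 => -[].
apply: integral_ge0 => t /=; rewrite in_itv /= => t01; apply: IHd => u u01.
apply: f0 => j; rewrite mxE; case: splitP => i _; last exact: u01.
by rewrite (ord1 i) mxE mulr1n.
Qed.

(** The relation is assumed on the open cube only, since the densities of a piece and of its image
    are compared where the piece lies in the orbit. *)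
Lemma cube_integral_scale d (f g : 'rV[R]_d -> \bar R) (k : R) : (0 < k)%R ->
  (forall u, @open_cube R d u -> 0 <= f u) ->
  (forall u, @open_cube R d u -> g u = k%:E * f u) ->
  cube_integral g = k%:E * cube_integral f.
Proof.
move=> k0; elim: d f g => [|d IHd] f g f0 gf /=; first by apply: gf => -[].
have cube (t : R) (u : 'rV[R]_d) : (0 < t < 1)%R -> @open_cube R d u ->
    @open_cube R d.+1 (row_mx t%:M u : 'rV_(1 + d)).
  move=> t01 u01 j; rewrite mxE; case: splitP => i _; last exact: u01.
  by rewrite (ord1 i) mxE mulr1n.
rewrite -integral_scale //; last first.
  move=> t /=; rewrite in_itv /= => t01; apply: cube_integral_ge0 => u u01.
  exact/f0/cube.
apply: eq_integral => t /set_mem /=; rewrite in_itv /= => t01.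
by apply: IHd => u u01; [apply: f0|apply: gf]; exact: cube.
Qed.

End VolumeScaling.

Lemma interpolation (F : fieldType) (I : finType) (x a : I -> F) :
  injective x -> exists p : {poly F}, forall i, p.[x i] = a i.
Proof.
move=> xI; pose q j : {poly F} := \prod_(k | k != j) ('X - (x k)%:P).
have q0 j : (q j).[x j] != 0.
  rewrite horner_prod; apply/prodf_neq0 => k kj.
  by rewrite hornerXsubC subr_eq0 (inj_eq xI) eq_sym.
exists (\sum_j (a j / (q j).[x j]) *: q j) => i.
rewrite horner_sum (bigD1 i) //= hornerZ divfK // big1 ?addr0 // => j ji.
have ij : i != j by rewrite eq_sym.
have qi : (q j).[x i] = 0 by rewrite horner_prod (bigD1 i) //= hornerXsubC subrr mul0r.
by rewrite hornerZ qi mulr0.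
Qed.

(** * Jacobians, and curves along lines in the cube *)

Section MatrixAnalysis.
Variable R : realType.

Lemma continuous_mx (T : topologicalType) m n (f : T -> 'M[R]_(m, n)) :
  (forall i j, continuous (fun x => f x i j)) -> continuous f.
Proof.
move=> fc x A [P Pn PA]; apply: filterS PA _ => /=.
suff : \forall y \near x, forall i j, P i j (f y i j) by [].
by apply: filter_forall => i; apply: filter_forall => j; exact: fc.
Qed.

Lemma jacobian_comp m n p (f : 'rV[R]_m -> 'rV[R]_n) (g : 'rV[R]_n -> 'rV[R]_p) x :
  differentiable f x -> differentiable g (f x) ->
  jacobian (g \o f) x = jacobian f x *m jacobian g (f x).
Proof.
move=> df dg; apply/row_matrixP => i; rewrite !rowE mulmxA.
by rewrite !mul_rV_lin1 diff_comp.
Qed.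

Lemma diff_coord m n (f : 'rV[R]_m -> 'rV[R]_n) x v j : differentiable f x ->
  'd f x v 0 j = 'd (fun x => f x 0 j) x v :> R.
Proof.
move=> df; have dc := differentiable_coord (f x) 0 j.
have E : (fun x => f x 0 j) = (fun y : 'rV[R]_n => y 0 j : R) \o f by [].
rewrite -!deriveE //; last by rewrite E; exact: differentiable_comp.
by rewrite derive_mx ?mxE //; exact: diff_derivable.
Qed.

Lemma jacobian_continuous_comp m n p (f : 'rV[R]_m -> 'rV[R]_n) (g : 'rV[R]_n -> 'rV[R]_p) :
  (forall x, differentiable f x) -> continuous (fun x => jacobian f x) ->
  (forall j, polyfun (fun x => g x 0 j)) ->
  continuous (fun x => jacobian (g \o f) x).
Proof.
move=> df cf pg.
have dg y : differentiable g y.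
  by apply: differentiable_coords => j; have [] := polyfun_C1 (pg j).
have -> : (fun x => jacobian (g \o f) x) = (fun x => jacobian f x *m jacobian g (f x)).
  by apply/funext => x; exact: jacobian_comp.
apply: continuous_mx => i j.
have -> : (fun x => (jacobian f x *m jacobian g (f x)) i j) =
    (fun x => \sum_k jacobian f x i k * 'd (fun x => g x 0 j) (f x) (delta_mx 0 k)).
  apply/funext => x; rewrite mxE; apply: eq_bigr => k _; congr (_ * _).
  by rewrite mxE -diff_coord.
apply: continuous_big => [|k _ x]; first exact: add_continuous.
have [_ c] := polyfun_C1 (pg j).
exact: (continuousM (continuous_comp (cf x) (@coord_continuous _ _ _ i k _))
  (continuous_comp (differentiable_continuous (df x)) (c (delta_mx 0 k) (f x)))).
Qed.

Lemma cube_near d (u v : 'rV[R]_d) : @open_cube R d u ->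
  \forall t \near (0 : R), @open_cube R d (u + t *: v).
Proof.
move=> u01.
suff : \forall t \near (0 : R), forall j, 0 < (u + t *: v) 0 j < 1 by [].
have FF : Filter (nbhs (0 : R)) by exact: nbhs_filter.
apply: (@filter_forall _ _ (fun j t => is_true (0 < (u + t *: v) 0 j < 1)) _ FF) => j.
have c : continuous (fun t : R => (u + t *: v) 0 j).
  have -> : (fun t : R => (u + t *: v) 0 j) = (fun t => u 0 j + t * v 0 j).
    by apply/funext => t; rewrite !mxE.
  by move=> t; exact: (cvgD (cvg_cst _) (cvgM cvg_id (cvg_cst _))).
have c0 : (u + 0 *: v) 0 j \in `]0, 1[ by rewrite !mxE mul0r addr0 in_itv; exact: u01.
have h := c 0 _ (@near_in_itvoo _ _ _ _ c0).
by apply: (@filterS _ _ FF _ _ _ h) => t /=; rewrite in_itv.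
Qed.

Lemma is_derive_line m n (f : 'rV[R]_m -> 'rV[R]_n) x v : differentiable f x ->
  is_derive (0 : R) (1 : R) (fun t => f (x + t *: v)) ('d f x v).
Proof.
move=> df; have E : (fun h : R => h^-1 *: (((fun t => f (x + t *: v)) \o shift 0) (h *: 1)
      - f (x + 0 *: v))) = (fun h : R => h^-1 *: ((f \o shift x) (h *: v) - f x)).
  apply/funext => h /=; rewrite scale0r !addr0 [h *: 1]mulr1.
  by rewrite [x + _]addrC.
have dv : derivable f x v by exact: diff_derivable.
by split; [rewrite /derivable E|rewrite /derive E -deriveE].
Qed.

End MatrixAnalysis.

Section OrbitVolume.
Variables (R : realType) (n' : nat).
Local Notation n := n'.+1.
Local Notation N := (n * n + n * n)%N.
Local Notation C := R[i].
Implicit Types (u g : 'M[C]_n) (d : 'rV[R]_n) (x : 'rV[R]_N) (p : {poly C}).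

Lemma orbit_coordsP u d x : u \is unitarymx ->
  orbit_coords u d x <-> exists2 g, g \is unitarymx & x = real_coords (diag_point g d).
Proof.
move=> uU; split=> [[Y /(orbit_cdiagP _ _ uU)[g gU ->] <-]|[g gU ->]]; first by exists g.
by exists (diag_point g d); [apply/orbit_cdiagP; [exact: uU|exists g]|].
Qed.

Lemma orbit_coords_eq u v d : u \is unitarymx -> v \is unitarymx ->
  orbit_coords u d = orbit_coords v d.
Proof.
move=> uU vU; apply/seteqP; split=> x.
  by move/(orbit_coordsP _ _ uU)/(orbit_coordsP _ _ vU).
by move/(orbit_coordsP _ _ vU)/(orbit_coordsP _ _ uU).
Qed.

(** An equivariant map defined on all matrices, so it can be composed with a piece even where the
    piece leaves the orbit. *)
Definition transport p (X : 'M[C]_n) : 'M[C]_n := horner_gram p X *m X.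

Lemma mxpolyfun_transport p : mxpolyfun (transport p \o @complex_coords R n').
Proof.
by apply: mxpolyfunM; [exact: mxpolyfun_horner_gram|exact: mxpolyfun_complex_coords].
Qed.

Definition transport_coords p x : 'rV[R]_N := real_coords (transport p (complex_coords x)).

Lemma polyfun_transport_coords p j : polyfun (fun x => transport_coords p x 0 j).
Proof. exact: (polyfun_real_coords (mxpolyfun_transport p)). Qed.

Definition transports p (d0 d : 'rV[R]_n) : Prop :=
  forall j, p.[(d0 0 j ^+ 2)%:C%C] * (d0 0 j)%:C%C = (d 0 j)%:C%C.

Lemma transport_diag_point p d0 d g : transports p d0 d -> g \is unitarymx ->
  transport p (diag_point g d0) = diag_point g d.
Proof.
move=> pd gU; rewrite /transport /diag_point horner_gram_orbit //.
apply: etrans (mul_unitary_congr _ _ gU) _.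
apply: (congr1 (fun A => g *m A *m g^T)).
rewrite mulmx_diag; congr diag_mx; apply/rowP => i; rewrite !mxE.
exact: pd.
Qed.

(** Interpolation at the nodes d0_j^2, distinct because the d0_j are positive and distinct; the
    prescribed values are d_j / d0_j. *)
Lemma transports_exists d0 d : (forall j, 0 < d0 0 j) -> injective (d0 0) ->
  exists p, transports p d0 d.
Proof.
move=> d0_gt0 d0I.
have xI : injective (fun j => (d0 0 j ^+ 2)%:C%C).
  move=> j k /complexI /eqP; rewrite eqrXn2 ?ltW // => /eqP; exact: d0I.
have [p pE] := interpolation (fun j => (d 0 j)%:C%C / (d0 0 j)%:C%C) xI.
exists p => j; rewrite pE divfK // -(rmorph0 (real_complex R)).
by rewrite (inj_eq (@complexI R)) gt_eqF.
Qed.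

Lemma transport_coordsK p q d0 d x : transports p d0 d -> transports q d d0 ->
  orbit_coords 1%:M d0 x -> transport_coords q (transport_coords p x) = x.
Proof.
move=> pd qd /(orbit_coordsP _ _ (unitary1 R n'))[g gU ->].
rewrite /transport_coords !real_coordsK (transport_diag_point pd gU).
by rewrite (transport_diag_point qd gU).
Qed.

Lemma transport_coords_orbit p d0 d x : transports p d0 d ->
  orbit_coords 1%:M d0 x -> orbit_coords 1%:M d (transport_coords p x).
Proof.
move=> pd /(orbit_coordsP _ _ (unitary1 R n'))[g gU ->].
rewrite /transport_coords real_coordsK (transport_diag_point pd gU).
by apply/(orbit_coordsP _ _ (unitary1 R n')); exists g.
Qed.

(** The map sends the curve of a generator through g D0 g^t to the curve of the same generator
    through g D g^t. Their velocities are one vector scaled by the two roots, so this vector is an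
    eigenvector of the differential. *)
Lemma diff_transport_coords p d0 d g j k : transports p d0 d -> g \is unitarymx ->
  root_val d0 j k != 0 ->
  'd (transport_coords p) (real_coords (diag_point g d0))
     (real_coords (g *m tangent_gen R j k *m g^T))
  = (root_val d j k / root_val d0 j k) *: real_coords (g *m tangent_gen R j k *m g^T).
Proof.
move=> pd gU r0; have h := cderive_orbit_curve g j k d0.
have := polymap_cderive (mxpolyfun_transport p) h.
have -> : transport p \o orbit_curve g j k d0 = orbit_curve g j k d.
  apply/funext => t; rewrite /= /orbit_curve.
  apply: (transport_diag_point pd); apply: (unitarycM gU).
  by apply: skew_curve_unitary; [exact: skew_gen_adj|exact: skew_gen_cube].
move=> /(cderive_unique (cderive_orbit_curve g j k d)).
rewrite orbit_curve0 => /(congr1 (@real_coords R n)).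
rewrite complex_coordsK !real_coordsZ linearZ /= => /(congr1 ( *:%R (root_val d0 j k)^-1)).
by rewrite !scalerA mulVf // scale1r mulrC => ->.
Qed.

Lemma jacobian_transport p d0 d g : transports p d0 d -> g \is unitarymx ->
  (forall i, root_row d0 0 i != 0) ->
  tangent_mx g *m jacobian (transport_coords p) (real_coords (diag_point g d0))
  = diag_mx (\row_i (root_row d 0 i / root_row d0 0 i)) *m tangent_mx g.
Proof.
move=> pd gU r0; apply/row_matrixP => i.
rewrite !row_mul row_diag_mx -scalemxAl -rowE mul_rV_lin1 rowK.
rewrite (diff_transport_coords pd gU); first by rewrite !mxE.
by have := r0 i; rewrite mxE.
Qed.

Lemma differentiable_transport_coords p x : differentiable (transport_coords p) x.
Proof.
by apply: differentiable_coords => j; have [] := polyfun_C1 (polyfun_transport_coords p j).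
Qed.

Lemma jacobian_patch d0 m (phi : 'rV[R]_m -> 'rV[R]_N) w g :
  (forall j, 0 <= d0 0 j) ->
  Defs.patch (orbit_coords 1%:M d0) phi -> @open_cube R m w ->
  g \is unitarymx -> phi w = real_coords (diag_point g d0) ->
  exists B, jacobian phi w = B *m tangent_mx g.
Proof.
move=> d_ge0 [dphi _ _ sub] w01 gU phiw.
suff : (jacobian phi w <= tangent_mx g)%MS by move/submxP.
apply/row_subP => i.
pose v : 'rV[R]_m := delta_mx 0 i.
have dc : is_derive (0 : R) (1 : R) (fun t => phi (w + t *: v)) (row i (jacobian phi w)).
  by rewrite rowE mul_rV_lin1; exact: is_derive_line.
have c0 : phi (w + 0 *: v) = real_coords (diag_point g d0) by rewrite scale0r addr0.
have [|b [-> _]] := tangent_vector_rows gU d_ge0 _ c0 dc; last exact: submxMl.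
have near01 := cube_near v w01.
near=> t; rewrite -/(orbit_coords g d0) (orbit_coords_eq d0 gU (unitary1 R n')).
by apply: sub; exists (w + t *: v) => //; near: t.
Unshelve. all: by end_near. Qed.

Definition volume_ratio d0 d : R :=
  `|\prod_i (root_row d 0 i / root_row d0 0 i)|.

(** There are as many parameters as tangent rows, so the two Jacobians are B M and B L M with B and
    L square. Both Gram determinants contain det(B)^2 det(M M^t), and their ratio is det(L)^2. *)
Lemma volume_density_transport p d0 d (phi : 'rV[R]_(n * n) -> 'rV[R]_N) w :
  transports p d0 d -> (forall j, 0 <= d0 0 j) -> (forall i, root_row d0 0 i != 0) ->
  Defs.patch (orbit_coords 1%:M d0) phi -> @open_cube R _ w ->
  volume_density (transport_coords p \o phi) w = volume_ratio d0 d * volume_density phi w.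
Proof.
move=> pd d_ge0 r0 pphi w01; have [dphi _ _ sub] := pphi.
have /(orbit_coordsP _ _ (unitary1 R n'))[g gU phiw] : orbit_coords 1%:M d0 (phi w).
  by apply: sub; exists w.
have [B JB] := jacobian_patch d_ge0 pphi w01 gU phiw.
rewrite /volume_density jacobian_comp //; last exact: differentiable_transport_coords.
rewrite JB phiw -(mulmxA B) (jacobian_transport pd gU r0).
set L := diag_mx _; set M := tangent_mx g.
have E (A : 'M[R]_(n * n)) : \det ((A *m M) *m (A *m M)^T) = \det A ^+ 2 * \det (M *m M^T).
  by rewrite trmx_mul !mulmxA -(mulmxA A) !det_mulmx det_tr; ring.
rewrite mulmxA !E det_mulmx exprMn (mulrC (_ ^+ 2)) -mulrA sqrtrM ?sqr_ge0 //.
rewrite sqrtr_sqr /volume_ratio det_diag; congr (`|_| * _).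
by apply: eq_bigr => i _; rewrite !mxE.
Qed.

(** The map q back to D0 inverts the first one on the orbit, whence injectivity on the cube. *)
Lemma patch_transport p q d0 d m (phi : 'rV[R]_m -> 'rV[R]_N) :
  transports p d0 d -> transports q d d0 ->
  Defs.patch (orbit_coords 1%:M d0) phi ->
  Defs.patch (orbit_coords 1%:M d) (transport_coords p \o phi).
Proof.
move=> pd qd [dphi cphi iphi sub].
have sub' w : @open_cube R m w -> orbit_coords 1%:M d0 (phi w).
  by move=> w01; apply: sub; exists w.
split.
- by move=> w; apply: differentiable_comp => //; exact: differentiable_transport_coords.
- exact: (jacobian_continuous_comp dphi cphi (polyfun_transport_coords p)).
- move=> w w' w01 w01' /= /(congr1 (transport_coords q)).
  rewrite !(transport_coordsK pd qd); [exact: iphi| |].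
    exact/sub'/(set_mem w01').
  exact/sub'/(set_mem w01).
- by move=> _ [w w01 <-]; apply: (transport_coords_orbit pd); exact: sub'.
Qed.

Lemma volume_orbit_le d0 d : (forall j, 0 <= d0 0 j) -> (forall j, 0 <= d 0 j) ->
  (forall i, root_row d0 0 i != 0) -> (forall i, root_row d 0 i != 0) ->
  ((volume_ratio d0 d)%:E * volume (n * n) (orbit_coords 1%:M d0)
    <= volume (n * n) (orbit_coords 1%:M d))%E.
Proof.
move=> d0_ge0 d_ge0 r0 r.
have [d0_gt0 d0I] := root_row_neq0 d0_ge0 r0.
have [d_gt0 dI] := root_row_neq0 d_ge0 r.
have [p pd] := transports_exists d d0_gt0 d0I.
have [q qd] := transports_exists d0 d_gt0 dI.
have k0 : 0 < volume_ratio d0 d.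
  by rewrite normr_gt0; apply/prodf_neq0 => i _; rewrite mulf_neq0 ?invr_eq0.
rewrite -lee_pdivlMl //; apply: ge_ereal_sup => _ [m [phi [pphi tphi ->]]].
rewrite lee_pdivlMl //; apply: ereal_sup_ubound.
exists m, (fun i => transport_coords p \o phi i); split.
- by move=> i; exact: patch_transport pd qd (pphi i).
- move=> i j _ _ [_ [[w w01 <-] [w' w01' /= e]]]; apply: tphi => //.
  exists (phi i w); split; first by exists w.
  exists w' => //; move/(congr1 (transport_coords q)): e.
  have [_ _ _ si] := pphi i; have [_ _ _ sj] := pphi j.
  rewrite !(transport_coordsK pd qd) //; first by apply: si; exists w.
  by apply: sj; exists w'.
rewrite ge0_sume_distrr; last first.
  by move=> i _; apply: cube_integral_ge0 => w _; rewrite lee_fin sqrtr_ge0.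
apply: eq_bigr => i _; apply/esym; apply: cube_integral_scale k0 _ _ => w w01.
  by rewrite lee_fin sqrtr_ge0.
by rewrite /= (volume_density_transport pd d0_ge0 r0 (pphi i) w01) EFinM.
Qed.

Lemma volume_ratioV d0 d : (forall i, root_row d0 0 i != 0) ->
  (forall i, root_row d 0 i != 0) -> volume_ratio d d0 = (volume_ratio d0 d)^-1.
Proof.
move=> r0 r; rewrite /volume_ratio -normfV -prodfV; congr `|_|.
by apply: eq_bigr => i _; rewrite invf_div.
Qed.

(** The missing inequality is [volume_orbit_le] with d0 and d exchanged, whose ratio is the
    inverse. *)
Lemma volume_orbit d0 d : (forall j, 0 <= d0 0 j) -> (forall j, 0 <= d 0 j) ->
  (forall i, root_row d0 0 i != 0) -> (forall i, root_row d 0 i != 0) ->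
  volume (n * n) (orbit_coords 1%:M d) =
    ((volume_ratio d0 d)%:E * volume (n * n) (orbit_coords 1%:M d0))%E.
Proof.
move=> d0_ge0 d_ge0 r0 r; apply/eqP; rewrite eq_le volume_orbit_le // andbT.
have k0 : 0 < volume_ratio d0 d.
  by rewrite normr_gt0; apply/prodf_neq0 => i _; rewrite mulf_neq0 ?invr_eq0.
by rewrite -lee_pdivrMl // -volume_ratioV // volume_orbit_le.
Qed.

(* At infinite x both sides are 0, the junk value of fine. *)
Lemma fine_scale (k : R) (x : \bar R) : 0 < k -> fine (k%:E * x)%E = k * fine x.
Proof.
move=> k0; case: x => [r| |] //=; first by rewrite mulr0 gt0_muley ?lte_fin.
by rewrite mulr0 gt0_muleNy ?lte_fin.
Qed.

(** Comparison with the orbit of [ref_diag] determines c: the square of its volume divided by the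
    product of its roots. At a singular point a root vanishes and both sides are 0. *)
Lemma discriminant_diag : exists c : R, 0 <= c /\ forall u d,
  u \is unitarymx -> (forall j, 0 <= d 0 j) ->
  discriminant (diag_point u d) = c * (\prod_i root_row d 0 i) ^+ 2.
Proof.
pose d0 := ref_diag R n'.
have d0_ge0 : forall j, 0 <= d0 0 j by exact: ref_diag_ge0.
have r0 : forall i, root_row d0 0 i != 0 by exact: root_row_ref.
pose v0 := fine (volume (n * n) (orbit_coords 1%:M d0)).
exists ((v0 / \prod_i root_row d0 0 i) ^+ 2); split; first exact: sqr_ge0.
move=> u d uU d_ge0; rewrite /discriminant.
have rP := regularP uU d_ge0.
case: ifPn => [/asboolP rX|/asboolP nrX]; last first.
  have [i ri] : exists i, root_row d 0 i = 0.
    apply: contrapT => h; apply: nrX; apply/rP => i.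
    by apply/eqP => ri; apply: h; exists i.
  have -> : \prod_i root_row d 0 i = 0 by rewrite (bigD1 i) //= ri mul0r.
  by rewrite expr0n mulr0.
have r := rP.1 rX; rewrite (covering_index_regular rX) expr1n mul1r.
have k0 : 0 < volume_ratio d0 d.
  by rewrite normr_gt0; apply/prodf_neq0 => i _; rewrite mulf_neq0 ?invr_eq0.
rewrite /orbit_volume (orbit_dim_regular uU d_ge0 r) -/(orbit_coords u d).
rewrite (orbit_coords_eq d uU (unitary1 R n')) (volume_orbit d0_ge0 d_ge0 r0 r).
rewrite fine_scale // -/v0 exprMn /volume_ratio real_normK ?num_real //.
by rewrite prodf_div !exprMn; ring.
Qed.

End OrbitVolume.

(** * The sum of squares *)

(** Pairing (j, k) with (k, j) will combine d_k - d_j and d_k + d_j into d_k^2 - d_j^2. *)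
Lemma prod_pairs (A : comNzRingType) n (F : 'I_n -> 'I_n -> A) :
  \prod_j \prod_k F j k =
  (\prod_j F j j) * \prod_(j < n) \prod_(k < n | (j < k)%N) (F j k * F k j).
Proof.
transitivity (\prod_(j < n) (F j j *
    ((\prod_(k < n | (j < k)%N) F j k) * \prod_(k < n | (k < j)%N) F j k))).
  apply: eq_bigr => j _; rewrite (bigID (fun k : 'I_n => (j < k)%N)) /=.
  rewrite [X in _ * X](bigD1 j) ?ltnn //= mulrCA; congr (_ * (_ * _)).
  by apply: eq_bigl => k; rewrite -leqNgt andbC -ltn_neqAle.
rewrite !big_split /=; congr (_ * _).
under [RHS]eq_bigr => j _ do rewrite big_split /=.
rewrite big_split /=; congr (_ * _).
by rewrite (exchange_big_dep xpredT).
Qed.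

Section SumOfSquares.
Variables (R : realType) (n' : nat).
Local Notation n := n'.+1.
Local Notation N := (n * n + n * n)%N.
Local Notation C := R[i].
Local Notation Re := (@complex.Re R).
Local Notation Im := (@complex.Im R).
Implicit Types (u X : 'M[C]_n) (d : 'rV[R]_n) (f : 'I_n -> 'I_n).

(** The modulus of det X supplies the long roots up to the factor 2^n, and the norm of the form
    supplies the others. *)
Definition discr_coef f X : C := \det X * cyclic_coef (gram_mx X) f.

(** The Vandermonde product of the squares d_j^2, not the square of a Vandermonde product. *)
Definition sq_vandermonde d : R :=
  \prod_(i < n) \prod_(j < n | (i < j)%N) (d 0 j ^+ 2 - d 0 i ^+ 2).

Lemma prod_root_row d :
  \prod_i root_row d 0 i = 2 ^+ n * (\prod_j d 0 j) * sq_vandermonde d.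
Proof.
transitivity (\prod_j \prod_k root_val d j k).
  rewrite pair_bigA (reindex _ (curry_mxvec_bij n n)) /=.
  by apply: eq_bigr => -[j k] _; rewrite mxE index_pairK.
rewrite prod_pairs; congr (_ * _).
  under eq_bigr => j _ do rewrite /root_val ltnn -mulr2n -mulr_natl.
  by rewrite big_split /= prodr_const card_ord.
apply: eq_bigr => j _; apply: eq_bigr => k jk.
rewrite /root_val jk ltnNge (ltnW jk) /=.
by rewrite subr_sqr.
Qed.

Lemma sum_discr_coef u d : u \is unitarymx -> (forall j, 0 <= d 0 j) ->
  \sum_(f : {ffun 'I_n -> 'I_n})
    (Re (discr_coef f (diag_point u d)) ^+ 2 + Im (discr_coef f (diag_point u d)) ^+ 2)
  = n`!%:R * ((\prod_j d 0 j) * sq_vandermonde d) ^+ 2.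
Proof.
move=> uU d_ge0; apply: (@complexI R); rewrite rmorph_sum /=.
under eq_bigr => f _ do rewrite add_Re2_Im2 /discr_coef normrM exprMn.
rewrite -mulr_sumr /diag_point (gram_orbit d uU).
rewrite (sum_cyclic_coef _ uU) det_Vandermonde.
rewrite !det_mulmx det_tr !normrM (unitary_det_norm uU) mul1r mulr1 det_diag.
have -> : \prod_i (map_mx (real_complex R) d) 0 i = (\prod_j d 0 j)%:C%C.
  by rewrite rmorph_prod; apply: eq_bigr => i _; rewrite mxE.
have -> : \prod_(i < n) \prod_(j < n | (i < j)%N)
    ((map_mx (fun x => (x ^+ 2)%:C%C) d) 0 j - (map_mx (fun x => (x ^+ 2)%:C%C) d) 0 i)
    = (sq_vandermonde d)%:C%C.
  rewrite rmorph_prod; apply: eq_bigr => i _; rewrite rmorph_prod.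
  by apply: eq_bigr => j _; rewrite !mxE rmorphB.
have nr (x : R) : `|x%:C%C| ^+ 2 = (x ^+ 2)%:C%C.
  by rewrite real_normK ?rmorphXn // complex_real.
rewrite !nr exprMn [RHS]rmorphM [X in _ = _ * X]rmorphM rmorph_nat.
exact: mulrCA.
Qed.

Lemma cpolyfun_discr_coef f : cpolyfun (fun x => discr_coef f (@complex_coords R n' x)).
Proof.
have pC := @mxpolyfun_complex_coords R n'.
apply: cpolyfunM; first exact: cpolyfun_det.
apply: cpolyfun_sum => s; apply: cpolyfun_det => i k.
under eq_fun do rewrite mxE.
exact: (mxpolyfun_exp k (mxpolyfunM pC (mxpolyfun_adj pC))).
Qed.

Lemma polyfun_scaled_sqrt (g : 'rV[R]_N -> R) (k : R) : 0 <= k -> polyfun g ->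
  exists p : mpoly.mpoly N R, forall X : 'M[C]_n,
    poly_eval p X ^+ 2 = k * g (real_coords X) ^+ 2.
Proof.
move=> k0 pg; have [p pE] := polyfun_meval (polyfunM (polyfun_cst _ (Num.sqrt k)) pg).
by exists p => X; rewrite /poly_eval pE exprMn sqr_sqrtr.
Qed.

Lemma discriminant_sum_squares :
  exists p : 'I_(2 * 'C(2 * n - 1, n)) -> mpoly.mpoly N R,
    forall X : 'M[C]_n, sym_matrix X ->
      discriminant X = \sum_i poly_eval (p i) X ^+ 2.
Proof.
have [c [c0 cE]] := discriminant_diag R n'.
pose F X f : R := Re (discr_coef f X) ^+ 2 + Im (discr_coef f X) ^+ 2.
pose A := [set t : n.-tuple 'I_n | sorted leq (map val t)].
have discr_f f g : f =1 g -> forall X, discr_coef f X = discr_coef g X.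
  by move=> fg X; rewrite /discr_coef (eq_cyclic_coef _ fg).
have [m mE] : exists m : n.-tuple 'I_n -> nat, forall X,
    \sum_(f : {ffun 'I_n -> 'I_n}) F X f = \sum_(t in A) F X (tnth t) *+ m t.
  have [m mE] := sum_ffun_sorted R n'; exists m => X; apply: mE.
  - by move=> f g fg; rewrite /F (discr_f _ _ fg).
  - by move=> f s; rewrite /F /discr_coef cyclic_coef_perm.
(* The factor c comes from the volume, 2 ^+ n from the roots 2 d_j, and n! from the norm in
   [sum_discr_coef]. *)
pose k := c * (2 ^+ n) ^+ 2 / n`!%:R.
have k0 : 0 <= k by rewrite divr_ge0 ?ler0n // mulr_ge0 // sqr_ge0.
have dE X : sym_matrix X -> discriminant X = \sum_(t in A) k *+ m t * F X (tnth t).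
  move=> /takagi_real[u [d [uU d_ge0 ->]]].
  transitivity (k * \sum_(f : {ffun 'I_n -> 'I_n}) F (diag_point u d) f).
    rewrite /F sum_discr_coef // cE // prod_root_row /k.
    have nf : n`!%:R != 0 :> R by rewrite pnatr_eq0 -lt0n fact_gt0.
    by rewrite -(mulrA (2 ^+ n)) [in LHS]exprMn -!mulrA mulKf.
  by rewrite mE mulr_sumr; apply: eq_bigr => t _; rewrite mulrnAr mulrnAl.
(* Sorted n-tuples are multisets of size n in n indices, counted by 'C(n + (n - 1), n). *)
have cardA : #|A| = 'C(2 * n - 1, n).
  by rewrite card_sorted_tuples; congr 'C(_, _); rewrite mul2n -addnn addnS subn1.
have pr t : exists p : mpoly.mpoly N R, forall X : 'M[C]_n,
    poly_eval p X ^+ 2 = k *+ m t * Re (discr_coef (tnth t) X) ^+ 2.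
  have [|p pE] := @polyfun_scaled_sqrt _ (k *+ m t) _ (cpolyfun_discr_coef (tnth t)).1.
    exact: mulrn_wge0.
  by exists p => X; rewrite pE real_coordsK.
have pi t : exists p : mpoly.mpoly N R, forall X : 'M[C]_n,
    poly_eval p X ^+ 2 = k *+ m t * Im (discr_coef (tnth t) X) ^+ 2.
  have [|p pE] := @polyfun_scaled_sqrt _ (k *+ m t) _ (cpolyfun_discr_coef (tnth t)).2.
    exact: mulrn_wge0.
  by exists p => X; rewrite pE real_coordsK.
have [p1 p1E] := choice pr; have [p2 p2E] := choice pi.
rewrite -cardA mul2n -addnn.
(* The first half of the indices carries the real parts, the second half the imaginary parts. *)
exists (fun i => match fintype.split i with
  | inl j => p1 (enum_val j) | inr j => p2 (enum_val j) end) => X symX.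
rewrite (dE X symX) big_split_ord /= -big_split /= big_enum_val.
apply: eq_bigr => j _.
by rewrite (unsplitK (inl j)) (unsplitK (inr j)) p1E p2E /F mulrDr.
Qed.

End SumOfSquares.

Theorem theorem3 (R : realType) (n : nat) (n_ge1 : (1 <= n)%N) :
  exists p : 'I_(2 * 'C(2 * n - 1, n)) -> mpoly.mpoly (n * n + n * n) R,
    forall X : 'M[R[i]]_n, sym_matrix X ->
      discriminant X = \sum_i poly_eval (p i) X ^+ 2.
Proof. by case: n n_ge1 => [//|n' _]; exact: discriminant_sum_squares. Qed.
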